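(* Let $\sigma,y,\beta$ be strictly positive real numbers such that $\varepsilon:=\frac{\beta}{\sigma^2y}\in(0,1)$. Let $X_1,\dots,X_n$ be independent real-valued random variables with sum $S:=X_1+\dots+X_n$, such that $\sum_i \mathsf{E}X_i^2\le\sigma^2$, $\sum_i\mathsf{E}(X_i)_+^3\le\beta$, and, for all $i$, $\mathsf{E}X_i\le0$ and $X_i\le y$ almost surely. Then for all $x\in\mathbb{R}$ $$\mathsf{P}(S\ge x)\le P_3\big(\Gamma_{(1-\varepsilon)\sigma^2}+y\tilde\Pi_{\varepsilon\sigma^2/y^2};x\big)\le c_{3,0}\,\mathsf{P}^{\mathsf{LC}}\big(\Gamma_{(1-\varepsilon)\sigma^2}+y\tilde\Pi_{\varepsilon\sigma^2/y^2}\ge x\big).$$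
   Context: Notation: $x_+:=\max(0,x)$ and $x_+^\alpha:=(x_+)^\alpha$. For $a>0$ and $\theta>0$, $\Gamma_{a^2}$ and $\Pi_\theta$ denote independent random variables with $\Gamma_{a^2}\sim N(0,a^2)$ (normal) and $\Pi_\theta\sim\mathrm{Pois}(\theta)$ (Poisson), and $\tilde\Pi_\theta:=\Pi_\theta-\theta$. For a random variable $\eta$, $\alpha>0$ and $x\in\mathbb{R}$, $P_\alpha(\eta;x):=\inf_{t\in(-\infty,x)}\frac{\mathsf{E}(\eta-t)_+^\alpha}{(x-t)^\alpha}$. The constant $c_{3,0}$ equals $\Gamma(4)(e/3)^3=2e^3/9$ (here $\Gamma(\cdot)$ is the Gamma function). For a random variable $\eta$, the function $x\mapsto\mathsf{P}^{\mathsf{LC}}(\eta\ge x)$ is the least log-concave majorant over $\mathbb{R}$ of the tail function $x\mapsto\mathsf{P}(\eta\ge x)$. *)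

(* Defs.v *)
From HB Require Import structures.
From mathcomp Require Import all_boot all_order all_algebra.
From mathcomp Require Import all_classical all_reals all_analysis.

Set Implicit Arguments.
Unset Strict Implicit.
Unset Printing Implicit Defensive.

Import Order.TTheory GRing.Theory Num.Theory.
Import numFieldNormedType.Exports.

Local Open Scope classical_set_scope.
Local Open Scope ring_scope.

Definition pospart (R : realType) (x : R) : R := Num.max 0 x.

(* Mutual independence: the product rule over every subfamily. *)
Definition mutually_independent d d' (T : measurableType d)
    (T' : measurableType d') (R : realType) (P : probability T R)
    (I : finType) (X : I -> {RV P >-> T'}) : Prop :=
  forall (J : {set I}) (A : I -> set T'), (forall i, measurable (A i)) ->
    P (\bigcap_(i in [set i | i \in J]) (X i @^-1` A i)) =
    (\prod_(i in J) P (X i @^-1` A i))%E.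
Arguments mutually_independent {d d' T T' R} P {I} X.

(* The two variables may take values in different spaces. *)
Definition independent2 d d1 d2 (T : measurableType d)
    (T1 : measurableType d1) (T2 : measurableType d2) (R : realType)
    (P : probability T R) (X : {RV P >-> T1}) (Y : {RV P >-> T2}) : Prop :=
  forall (A : set T1) (B : set T2), measurable A -> measurable B ->
    P (X @^-1` A `&` Y @^-1` B) = (P (X @^-1` A) * P (Y @^-1` B))%E.
Arguments independent2 {d d1 d2 T T1 T2 R} P X Y.

(* Laws are compared on measurable sets only: as functions on all subsets,
   distribution P X and mu may differ on nonmeasurable sets. *)
Definition has_law d d' (T : measurableType d) (T' : measurableType d')
    (R : realType) (P : probability T R) (X : {RV P >-> T'})
    (mu : set T' -> \bar R) : Prop :=
  forall A, measurable A -> distribution P X A = mu A.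
Arguments has_law {d d' T T' R} P X mu.

(* normal_prob takes the standard deviation as its second argument. *)
Definition gaussian_law (R : realType) (variance : R) : set R -> \bar R :=
  normal_prob 0 (Num.sqrt variance).

(* The second argument of poisson_prob is a dummy. *)
Definition poisson_law (R : realType) (theta : R) : set nat -> \bar R :=
  poisson_prob theta 0.

Definition P_alpha d (T : measurableType d) (R : realType)
    (P : probability T R) (alpha : R) (eta : T -> R) (x : R) : \bar R :=
  ereal_inf [set ('E_P[fun w => (pospart (eta w - t) `^ alpha)%R]
                  * (((x - t) `^ alpha)^-1)%:E)%E | t in `]-oo, x[ ].

(* Gamma(4) (e/3)^3, with Gamma(4) = 3! *)
Definition c30 (R : realType) : R := 2 * expR 1 ^+ 3 / 9.

(* At t = 0 or t = 1 the convention 0 `^ 0 = 1 makes the inequality trivial. *)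
Definition log_concave (R : realType) (f : R -> R) : Prop :=
  (forall x, 0 <= f x) /\
  forall x y t : R, 0 <= t <= 1 ->
    f x `^ t * f y `^ (1 - t) <= f (t * x + (1 - t) * y).

Definition log_concave_majorant (R : realType) (f g : R -> R) : Prop :=
  log_concave g /\ forall x, f x <= g x.

Definition is_least_log_concave_majorant (R : realType) (f g : R -> R) : Prop :=
  log_concave_majorant f g /\
  forall h, log_concave_majorant f h -> forall x, g x <= h x.

Definition least_log_concave_majorant (R : realType) (f : R -> R) (x : R) : R :=
  inf [set h x | h in [set h | log_concave_majorant f h]].

Lemma least_log_concave_majorantP (R : realType) (f : R -> R) (M : R) :
  (forall x, 0 <= f x <= M) ->
  is_least_log_concave_majorant f (least_log_concave_majorant f).
Proof.
move=> fM.
have M0 : 0 <= M by have /andP[] := fM 0; exact: le_trans.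
pose E x := [set h x | h in [set h | log_concave_majorant f h]].
have cM : log_concave_majorant f (fun=> M).
  split; last by move=> x; have /andP[] := fM x.
  split=> // x y t /andP[t0 t1].
  have [->|Mn0] := eqVneq M 0.
    rewrite /powR eqxx; case: eqP => [->|_]; last by rewrite mul0r.
    by rewrite subr0 oner_eq0 mulr0.
  by rewrite -powRD ?Mn0 ?implybT// subrKC powRr1.
have En0 x : E x !=set0 by exists M; exists (fun=> M).
have Elb x : lbound (E x) 0 by move=> _ [h [[h0 _] _] <-]; exact: h0.
have Ele h : log_concave_majorant f h ->
    forall x, least_log_concave_majorant f x <= h x.
  by move=> fh x; apply: ge_inf; [exists 0; exact: Elb|exists h].
have ge0 x : 0 <= least_log_concave_majorant f x.
  exact: lb_le_inf (En0 x) (Elb x).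
split=> //; split; last first.
  move=> x; apply: lb_le_inf; first exact: En0.
  by move=> _ [h [_ fh] <-]; exact: fh.
split=> // x y t t01; apply: lb_le_inf; first exact: En0.
move=> _ [h fh <-]; have [[h0 hlc] _] := fh.
apply: le_trans (hlc x y t t01); have /andP[t0 t1] := t01.
by apply: ler_pM; rewrite ?powR_ge0// ge0_ler_powR ?nnegrE ?subr_ge0 ?Ele ?h0.
Qed.

Definition tail d (T : measurableType d) (R : realType)
    (P : probability T R) (eta : T -> R) (x : R) : R :=
  fine (P [set w | x <= eta w]).

Definition P_LC d (T : measurableType d) (R : realType)
    (P : probability T R) (eta : T -> R) : R -> R :=
  least_log_concave_majorant (tail P eta).

Lemma P_LCP d (T : measurableType d) (R : realType) (P : probability T R)
    (eta : {RV P >-> R}) :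
  is_least_log_concave_majorant (tail P eta) (P_LC P eta).
Proof.
apply: (@least_log_concave_majorantP _ _ 1) => x.
have mE : measurable [set w | x <= eta w].
  rewrite [X in measurable X](_ : _ = eta @^-1` `[x, +oo[).
    exact: measurable_funPTI.
  by apply/seteqP; split=> w /=; rewrite in_itv/= andbT.
rewrite fine_ge0//= -lee_fin fineK ?fin_num_measure//.
exact: probability_le1.
Qed.

(* Main.v *)
From HB Require Import structures.
Require Import Defs.
From mathcomp Require Import all_boot all_order all_algebra.
From mathcomp Require Import all_classical all_reals all_analysis measurable_realfun.
From mathcomp Require Import ring lra.

Set Implicit Arguments.
Unset Strict Implicit.
Unset Printing Implicit Defensive.

Import Order.TTheory GRing.Theory Num.Theory.
Import numFieldNormedType.Exports.
Local Open Scope classical_set_scope.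
Local Open Scope ring_scope.

(** The idea of the proof. Write [f c] for the third power of the positive part
  of [c].

  The first inequality is Markov's inequality for the functions
  [x |-> f (x - t)], once [E f (S + c) <= E f (eta + c)] is known for all real [c].
  The laws of [eta] form a two-parameter semigroup of normal and compensated
  Poisson laws with generator
  [L f c = v / 2 * f'' c + th * (f (c + y) - f c - y * f' c)].
  For a single variable [X <= y] with nonpositive mean, second moment at most
  [v + y ^+ 2 * th] and third moment of the positive part at most [y ^+ 3 * th],
  Taylor's formula gives [E f (X + c) <= f c + L f c], because the third
  derivative of [f] is nonnegative and nondecreasing
  ([expectation_cube_pos_le]). Conversely [f + L f] is below the mean of
  [f (. + c)] under the law with parameters [v], [th], because [L f] is convex and
  the law is centred ([taylor_bound_le_cube_moment]). So every summand may be
  replaced by a Gaussian-Poisson variable, one after the other, and the parameters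
  add up ([cube_moment_conv], [sum_le_cube_moment]). They can be chosen with the
  required totals ([sum_third_moment_le]).

  For the second inequality, let [h] be a log-concave majorant of the tail of
  [eta]. The normal part makes this tail positive everywhere, so [ln h] has a supporting line at [x], say of slope
  [- l]. If [l > 0], the tail at [u] is at most [h x * expR (- l * (u - x))], and the
  layer-cake formula bounds [E f (eta - t)] by [6 / l ^+ 3] times
  [h x * expR (l * (x - t))]; at [x - t = 3 / l] the quotient is [c30 * h x]. If
  [l <= 0], then [h x] is at least the limit [1] of the tail at [-oo], while the
  quotient tends to [1] as [t] tends to [-oo] ([P_alpha_le_c30]). *)

(** * Pointwise inequalities for the cube of the positive part *)

Section pointwise_inequalities.
Context {R : realType}.
Implicit Types c g u w x y : R.

Definition cube_pos x : R := pospart x ^+ 3.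

Lemma pospart_ge0 x : 0 <= pospart x.
Proof. by rewrite /pospart le_max lexx. Qed.

Lemma cube_pos_ge0 x : 0 <= cube_pos x.
Proof. by rewrite exprn_ge0 ?pospart_ge0. Qed.

Lemma pospart_ge x : x <= pospart x.
Proof. by rewrite /pospart le_max lexx orbT. Qed.

Lemma pospart_id x : 0 <= x -> pospart x = x.
Proof. by move=> x0; rewrite /pospart max_r. Qed.

Lemma pospart_eq0 x : x <= 0 -> pospart x = 0.
Proof. by move=> x0; rewrite /pospart max_l. Qed.

Lemma le_pospart x y : x <= y -> pospart x <= pospart y.
Proof.
by move=> xy; rewrite {1}/pospart ge_max pospart_ge0 (le_trans xy)// pospart_ge.
Qed.

Lemma le_cube_pos x y : x <= y -> cube_pos x <= cube_pos y.
Proof. by move=> xy; rewrite lerXn2r ?nnegrE ?pospart_ge0 ?le_pospart. Qed.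

Lemma cube_pos_id x : 0 <= x -> cube_pos x = x ^+ 3.
Proof. by move=> x0; rewrite /cube_pos pospart_id. Qed.

Lemma cube_pos_eq0 x : x <= 0 -> cube_pos x = 0.
Proof. by move=> x0; rewrite /cube_pos pospart_eq0// expr0n. Qed.

Lemma cube_pos_ge x : x ^+ 3 <= cube_pos x.
Proof.
have [x0|/ltW x0] := leP 0 x; first by rewrite cube_pos_id.
rewrite cube_pos_eq0// exprS mulr_le0_ge0// sqr_ge0 //.
Qed.

(** For the cube [f], this is [f (c + y) - f c - y * f' c]: the contribution of
  compensated jumps of size [y] to the generator of a Levy process. *)
Definition jump_term y c : R :=
  cube_pos (c + y) - cube_pos c - 3 * pospart c ^+ 2 * y.

Lemma jump_term_ge0 y c : 0 <= y -> 0 <= jump_term y c.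
Proof.
move=> y0; rewrite /jump_term; have [c0|/ltW c0] := leP 0 c.
  have cy : 0 <= c + y by lra.
  rewrite !cube_pos_id ?pospart_id//.
  have := mulr_ge0 c0 (sqr_ge0 y); have := exprn_ge0 3 y0; lra.
by rewrite (@cube_pos_eq0 c)// pospart_eq0// expr0n/= mulr0 mul0r !subr0 cube_pos_ge0.
Qed.

Lemma jump_term_pos y c : 0 <= y -> 0 <= c -> jump_term y c = 3 * c * y ^+ 2 + y ^+ 3.
Proof.
by move=> y0 c0; rewrite /jump_term !cube_pos_id ?pospart_id ?addr_ge0//; ring.
Qed.

Lemma jump_term_neg y c : c <= 0 -> jump_term y c = cube_pos (c + y).
Proof.
move=> c0; rewrite /jump_term (@cube_pos_eq0 c)// pospart_eq0//.
by rewrite expr0n/= mulr0 mul0r !subr0.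
Qed.

(** Convexity of [jump_term y]: on the three pieces [c <= - y], [- y <= c <= 0]
  and [0 <= c] it equals [0], [(c + y) ^+ 3] and [3 * c * y ^+ 2 + y ^+ 3], so the
  slope below is its derivative, which is nondecreasing in [c]. *)
Lemma jump_term_tangent y c z : 0 <= y ->
  jump_term y c + 3 * (Num.min y (pospart (c + y))) ^+ 2 * (z - c) <= jump_term y z.
Proof.
move=> y0.
have [c0|/ltW c0] := leP 0 c.
  rewrite (@jump_term_pos y c)// pospart_id ?addr_ge0// min_l ?lerDr//.
  have [z0|/ltW z0] := leP 0 z.
    by rewrite jump_term_pos//; lra.
  rewrite jump_term_neg//; have [zy|/ltW zy] := leP 0 (z + y).
    have : 0 <= z ^+ 2 * (z + 3 * y) by apply: mulr_ge0; [exact: sqr_ge0|lra].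
    by rewrite cube_pos_id//; lra.
  have : 0 <= y ^+ 2 * (- (3 * z + y)) by apply: mulr_ge0; [exact: sqr_ge0|lra].
  rewrite cube_pos_eq0//; lra.
rewrite (@jump_term_neg y c)//.
have [cy|/ltW cy] := leP 0 (c + y); last first.
  rewrite cube_pos_eq0// pospart_eq0// min_r// expr0n/= mulr0 mul0r addr0.
  exact: jump_term_ge0.
rewrite cube_pos_id// pospart_id// min_r ?gerDr//.
have [z0|/ltW z0] := leP 0 z.
  have : 0 <= z * ((- c) * (c + 2 * y)).
    by apply: mulr_ge0 => //; apply: mulr_ge0; lra.
  have : 0 <= c ^+ 2 * (3 * y + 2 * c) by apply: mulr_ge0; [exact: sqr_ge0|lra].
  rewrite jump_term_pos//; lra.
rewrite jump_term_neg//.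
have [zy|/ltW zy] := leP 0 (z + y).
  have : 0 <= (z - c) ^+ 2 * ((z + y) + 2 * (c + y)).
    by apply: mulr_ge0; [exact: sqr_ge0|lra].
  rewrite cube_pos_id//; lra.
have : 0 <= (c + y) ^+ 2 * (2 * (c + y) - 3 * (z + y)).
  by apply: mulr_ge0; [exact: sqr_ge0|lra].
rewrite cube_pos_eq0//; lra.
Qed.

Lemma jump_term_midpoint y c g : 0 <= y ->
  2 * jump_term y c <= jump_term y (c + g) + jump_term y (c - g).
Proof.
move=> y0; have := @jump_term_tangent y c (c + g) y0.
have := @jump_term_tangent y c (c - g) y0; lra.
Qed.

(** The second derivative [6 * pospart c] of the cube is convex in [c], so a
  symmetric second difference is at least its leading term. *)
Lemma cube_pos_midpoint c g :
  2 * cube_pos c + 6 * pospart c * g ^+ 2 <= cube_pos (c + g) + cube_pos (c - g).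
Proof.
have [c0|/ltW c0] := leP 0 c; last first.
  by rewrite cube_pos_eq0// pospart_eq0// !mulr0 mul0r addr0 addr_ge0 ?cube_pos_ge0.
rewrite cube_pos_id// pospart_id//.
have := cube_pos_ge (c + g); have := cube_pos_ge (c - g); lra.
Qed.

(** Second-order Taylor formula at [c]. The remainder is [x ^+ 3] times an average
  of the third derivative between [c] and [c + x]. That derivative is nonnegative,
  so the remainder is nonpositive for [x <= 0]; it is nondecreasing, so for
  [0 <= x <= y] the remainder is at most [(x / y) ^+ 3] times the remainder at
  [y], which is the last bracket. *)
Lemma cube_pos_taylor y c x : 0 < y -> x <= y ->
  cube_pos (x + c) <= cube_pos c + 3 * pospart c ^+ 2 * x + 3 * pospart c * x ^+ 2
    + cube_pos x / y ^+ 3 * (jump_term y c - 3 * pospart c * y ^+ 2).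
Proof.
move=> y0 xy; have y0' := ltW y0; have [c0|/ltW c0] := leP 0 c.
  rewrite jump_term_pos// pospart_id// (@cube_pos_id c)//.
  rewrite (addrAC (3 * c * _)) subrr add0r mulfVK ?gt_eqF ?exprn_gt0//.
  have [x0|/ltW x0] := leP 0 x.
    rewrite !cube_pos_id ?addr_ge0//; lra.
  rewrite (@cube_pos_eq0 x)//.
  have [xc|/ltW xc] := leP 0 (x + c).
    rewrite !cube_pos_id//; nra.
  rewrite cube_pos_eq0//.
  have : 0 <= c * (c ^+ 2 + 3 * c * x + 3 * x ^+ 2) by apply: mulr_ge0 => //; have := sqr_ge0 (2 * c + 3 * x); have := sqr_ge0 x; lra.
  lra.
rewrite jump_term_neg// pospart_eq0// (@cube_pos_eq0 c)//.
rewrite expr0n/= !(mulr0,mul0r,subr0,add0r).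
have [xc|/ltW xc] := leP (x + c) 0.
  by rewrite cube_pos_eq0// mulr_ge0 ?divr_ge0 ?cube_pos_ge0 ?exprn_ge0// ltW.
have x0 : 0 <= x by lra.
have cy : 0 <= c + y by lra.
rewrite !cube_pos_id// -expr_div_n -exprMn.
apply: lerXn2r; rewrite ?nnegrE//; first by rewrite mulr_ge0 ?divr_ge0.
have : 0 <= (- c) * (y - x) by apply: mulr_ge0; lra.
rewrite mulrAC ler_pdivlMr//; lra.
Qed.

Lemma pospart_jump_term_ge y c : 0 < y -> 0 <= jump_term y c - 3 * pospart c * y ^+ 2.
Proof.
move=> y0; have y0' := ltW y0; have [c0|/ltW c0] := leP 0 c.
  rewrite jump_term_pos// pospart_id//.
  have : 0 < y ^+ 3 by rewrite exprn_gt0.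
  lra.
by rewrite pospart_eq0// mulr0 mul0r subr0 jump_term_ge0.
Qed.

(** A Poisson variable centred at its mean [th] has first three moments [0], [th],
  [th], hence the left-hand side of the last equation is the mean of the cubic at
  it. So it suffices to find a cubic below [u |-> cube_pos (u - w)] that has the same
  value and slope as this function at [u = 0] and the same value at the jump
  [u = 1]. *)
Lemma cube_pos_cubic_minorant w : exists c0 c1 c2 c3 : R,
  (forall u, c0 + c1 * u + c2 * u ^+ 2 + c3 * u ^+ 3 <= cube_pos (u - w)) /\
  forall th, 0 <= th -> c0 + th * c2 + th * c3 = cube_pos (- w) + th * jump_term 1 (- w).
Proof.
have [w0|/ltW w0] := leP w 0.
  exists (- w ^+ 3), (3 * w ^+ 2), (- 3 * w), 1; split => [u|th th0].
    by apply: le_trans (cube_pos_ge _); lra.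
  by rewrite jump_term_pos// ?oppr_ge0// cube_pos_id ?oppr_ge0//; ring.
have [w1|/ltW w1] := leP w 1; last first.
  exists 0, 0, 0, 0; split => [u|th th0].
    by rewrite !mul0r !addr0 cube_pos_ge0.
  rewrite jump_term_neg ?oppr_le0// !cube_pos_eq0//; lra.
(* the cubic with a double zero at [0] that is tangent to [(u - w) ^+ 3] at [1] *)
exists 0, 0, (- (3 * w * (1 - w) ^+ 2)), ((1 - w) ^+ 2 * (1 + 2 * w)).
split => [u|th th0]; last first.
  rewrite jump_term_neg ?oppr_le0// cube_pos_eq0 ?oppr_le0// cube_pos_id; [ring|lra].
have [uw|/ltW uw] := leP 0 (u - w).
  rewrite cube_pos_id//.
  have -> : (u - w) ^+ 3 = 0 + 0 * u + - (3 * w * (1 - w) ^+ 2) * u ^+ 2 +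
      (1 - w) ^+ 2 * (1 + 2 * w) * u ^+ 3 + w ^+ 2 * (u-1) ^+ 2 * ((3 - 2 * w) * u - w) by ring.
  have : 0 <= (3 - 2 * w) * (u - w) by apply: mulr_ge0 => //; lra.
  have : 0 <= w * (1 - w) by apply: mulr_ge0 => //; lra.
  move=> h1 h2; rewrite lerDl; apply: mulr_ge0; last by lra.
  by apply: mulr_ge0; exact: sqr_ge0.
rewrite cube_pos_eq0//.
have -> : 0 + 0 * u + - (3 * w * (1 - w) ^+ 2) * u ^+ 2 +
      (1 - w) ^+ 2 * (1 + 2 * w) * u ^+ 3 = - ((1 - w) ^+ 2 * u ^+ 2 * (3 * w - (1 + 2 * w) * u)) by ring.
have h1 : 0 <= (1 + 2 * w) * (w - u) by apply: mulr_ge0; lra.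
have h2 : 0 <= w * (1 - w) by apply: mulr_ge0 => //; lra.
rewrite oppr_le0; apply: mulr_ge0; last by lra.
by apply: mulr_ge0; exact: sqr_ge0.
Qed.

End pointwise_inequalities.

(** * Integration against a density *)

Section density.
Context d (T : measurableType d) (R : realType).
Local Open Scope ereal_scope.
Variables (mu nu : {measure set T -> \bar R}) (p : T -> R).
Hypotheses (mp : measurable_fun setT p) (p0 : forall x, (0 <= p x)%R).
Hypothesis nuE : forall A, measurable A -> nu A = \int[mu]_(x in A) (p x)%:E.

Import HBNNSimple.

Let integral_density_nnsfun (h : {nnsfun T >-> R}) :
  \int[nu]_x (h x)%:E = \int[mu]_x ((h x)%:E * (p x)%:E).
Proof.
have -> : \int[nu]_x (h x)%:E =
    \sum_(r \in range h) (r%:E * nu (h @^-1` [set r])).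
  rewrite integralT_nnsfun sintegralE; apply: eq_fsbigr => r _.
  by [].
under [RHS]eq_integral => x _.
  rewrite fimfunE -fsumEFin// ge0_mule_fsuml; last first.
    by move=> r; rewrite EFinM nnfun_muleindic_ge0.
  over.
rewrite /= ge0_integral_fsum//; last 2 first.
- move=> r; apply: emeasurable_funM; last exact/measurable_EFinP.
  by apply/measurable_EFinP/measurable_funM.
- by move=> r x _; apply: mule_ge0; [rewrite EFinM nnfun_muleindic_ge0|rewrite lee_fin].
apply: eq_fsbigr => r /[!inE] -[t _ <-].
rewrite nuE// integral_mkcond -ge0_integralZl//; last 3 first.
- apply/(measurable_restrictT _ _).1 => //; exact/measurable_funTS/measurable_EFinP.
- by move=> x _; apply: erestrict_ge0 => y _; rewrite lee_fin.
- by rewrite lee_fin.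
apply: eq_integral => x _; rewrite patchE indicE EFinM.
by case: ifPn => _; rewrite ?mule1 ?mule0 ?mul0e.
Qed.

Lemma ge0_integral_density (f : T -> \bar R) :
  measurable_fun setT f -> (forall x, 0 <= f x) ->
  \int[nu]_x f x = \int[mu]_x (f x * (p x)%:E).
Proof.
move=> mf f0; pose f_ := nnsfun_approx measurableT mf.
have cvgf x : (f_ n x)%:E @[n --> \oo] --> f x by exact: cvg_nnsfun_approx.
transitivity (limn (fun n => \int[nu]_x (f_ n x)%:E)).
  rewrite -monotone_convergence//=.
  - by apply: eq_integral => x _; apply/esym/cvg_lim => //; exact: cvgf.
  - by move=> n; exact/measurable_EFinP.
  - by move=> n x _; rewrite lee_fin.
  - by move=> x _ m n mn; rewrite lee_fin; exact/lefP/nd_nnsfun_approx.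
under eq_fun do rewrite integral_density_nnsfun.
rewrite -monotone_convergence//=.
- apply: eq_integral => x _; apply/cvg_lim => //.
  by apply: cvgeZr => //; exact: cvgf.
- move=> n; apply: emeasurable_funM; exact/measurable_EFinP.
- by move=> n x _; rewrite mule_ge0// lee_fin.
- move=> x _ m n mn; rewrite lee_wpmul2r ?lee_fin//.
  exact/lefP/nd_nnsfun_approx.
Qed.

End density.

(** * Centred normal laws *)

(** Variance [0] has to give the unit mass at [0] for variances to add up under
  convolution; [normal_prob 0 0] is uniform on [[0, 1]]. The definition is locked
  because unification would otherwise compare two variances by unfolding the
  densities. *)
HB.lock Definition gauss {R : realType} (v : R) : probability (measurableTypeR R) R :=
  if v == 0 then (\d_(0 : measurableTypeR R) : probability _ R)
  else (normal_prob 0 (Num.sqrt v) : probability _ R).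

Section gauss.
Context {R : realType}.
Notation mu := (@lebesgue_measure R).
Implicit Types (a b c g m s u v x : R).

Lemma integral_gauss0 (f : R -> \bar R) : measurable_fun setT f ->
  (\int[gauss 0%R]_x f x = f 0%R)%E.
Proof.
by move=> mf; rewrite gauss.unlock eqxx integral_dirac// diracT mul1e.
Qed.

Lemma normal_pdf_varE m v x : 0 < v ->
  normal_pdf m (Num.sqrt v) x =
  (Num.sqrt (2 * pi * v))^-1 * expR (- ((x - m) ^+ 2 / (2 * v))).
Proof.
move=> v0; rewrite normal_pdfE ?gt_eqF ?sqrtr_gt0// /normal_peak /normal_fun.
rewrite sqr_sqrtr ?ltW// mulNr -(mulr_natl v) -(mulr_natl (v * pi)).
by congr ((Num.sqrt _)^-1 * _); ring.
Qed.

Lemma integral_gauss v (f : R -> \bar R) : 0 < v ->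
  measurable_fun setT f -> (forall x, 0 <= f x)%E ->
  (\int[gauss v]_x f x = \int[mu]_x (f x * (normal_pdf 0%R (Num.sqrt v) x)%:E))%E.
Proof.
move=> v0 mf f0; rewrite gauss.unlock gt_eqF//.
apply: ge0_integral_density => //.
- exact: measurable_normal_pdf.
- by move=> x; exact: normal_pdf_ge0.
Qed.

Lemma ge0_integral_translation (f : R -> \bar R) c :
  measurable_fun setT f -> (forall x, 0 <= f x)%E ->
  (\int[mu]_x f x = \int[mu]_x f (x + c)%R)%E.
Proof.
move=> mf f0; pose tr := (fun x => x + c) : measurableTypeR R -> measurableTypeR R.
have mtr : measurable_fun setT tr by exact: measurable_funD.
transitivity (\int[pushforward mu tr]_x f x)%E; last first.
  by rewrite ge0_integral_pushforward.
apply: eq_measure_integral => A mA _.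
apply: lebesgue_measure_unique => //= _ [[x y]] _ <-.
rewrite /pushforward [X in _ = lebesgue_measure X](_ : _ = `](x - c), (y - c)]%classic); last first.
  by apply/seteqP; split => z; rewrite /tr/= !in_itv/= ltrBlDr lerBrDr.
rewrite !lebesgue_measure_itv/= !lte_fin ltrD2r; case: ifPn => // _.
by rewrite -!EFinD; congr EFin; ring.
Qed.

Lemma ge0_integral_reflection (f : R -> \bar R) :
  measurable_fun setT f -> (forall x, 0 <= f x)%E ->
  (\int[mu]_x f (- x)%R = \int[mu]_x f x)%E.
Proof.
move=> mf f0; pose tr := (fun x => - x) : measurableTypeR R -> measurableTypeR R.
have mtr : measurable_fun setT tr by exact: oppr_measurable.
transitivity (\int[pushforward mu tr]_x f x)%E.
  by rewrite ge0_integral_pushforward.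
by apply: eq_measure_integral => A mA _; exact: lebesgue_measureN.
Qed.

Lemma ge0_integral_gauss_sym v (f : R -> \bar R) : 0 <= v ->
  measurable_fun setT f -> (forall x, 0 <= f x)%E ->
  (\int[gauss v]_x f (- x)%R = \int[gauss v]_x f x)%E.
Proof.
rewrite le_eqVlt => /predU1P[<-|v0] mf f0.
  by rewrite !integral_gauss0// ?oppr0//; exact: measurableT_comp.
have mfN : measurable_fun setT (fun x => f (- x)%R) by exact: measurableT_comp.
rewrite !integral_gauss//.
pose F x := (f x * (normal_pdf 0 (Num.sqrt v) x)%:E)%E.
have mF : measurable_fun setT F.
  apply: emeasurable_funM => //; apply/measurable_EFinP; exact: measurable_normal_pdf.
have F0 x : (0 <= F x)%E by rewrite mule_ge0// lee_fin normal_pdf_ge0.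
transitivity (\int[mu]_x F (- x)%R)%E; last exact: ge0_integral_reflection.
apply: eq_integral => x _; rewrite /F !normal_pdf_varE//.
by rewrite !subr0 sqrrN.
Qed.

(** Completing the square in [g]. *)
Lemma normal_pdf_mul a b g u : 0 < a -> 0 < b ->
  normal_pdf 0 (Num.sqrt a) g * normal_pdf 0 (Num.sqrt b) (u - g) =
  normal_pdf 0 (Num.sqrt (a + b)) u *
  normal_pdf (a * u / (a + b)) (Num.sqrt (a * b / (a + b))) g.
Proof.
move=> a0 b0; have ab0 : 0 < a + b by rewrite addr_gt0.
have p0 : 0 < pi :> R := pi_gt0 _.
rewrite !normal_pdf_varE ?divr_gt0 ?mulr_gt0//.
rewrite mulrACA [RHS]mulrACA -!expRD -!invfM -!sqrtrM ?mulr_ge0 ?(ltW p0) ?(ltW a0) ?(ltW ab0)//.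
congr ((Num.sqrt _)^-1 * expR _); field; rewrite ?gt_eqF//.
Qed.

Lemma measurable_integral_shift (nu : probability (measurableTypeR R) R)
    (f : R -> \bar R) : measurable_fun setT f -> (forall x, 0 <= f x)%E ->
  measurable_fun setT (fun g : R => \int[nu]_h f (g + h)%R)%E.
Proof.
move=> mf f0.
pose f2 (z : measurableTypeR R * measurableTypeR R) := f (z.1 + z.2).
have mf2 : measurable_fun setT f2.
  by apply: measurableT_comp => //; exact: measurable_funD.
have f20 z : (0 <= f2 z)%E by exact: f0.
exact: (@measurable_fun_fubini_tonelli_F _ _ _ _ _ nu f2 mf2 f20).
Qed.

(** Translate the inner variable, exchange the integrals, and integrate out [g]:
  by [normal_pdf_mul] what remains is the density of variance [a + b]. *)
Lemma gauss_conv a b (f : R -> \bar R) : 0 <= a -> 0 <= b ->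
  measurable_fun setT f -> (forall x, 0 <= f x)%E ->
  (\int[gauss a]_g \int[gauss b]_h f (g + h)%R = \int[gauss (a + b)]_x f x)%E.
Proof.
rewrite le_eqVlt => /predU1P[<-|a0].
  move=> b0 mf f0.
  rewrite (integral_gauss0 (measurable_integral_shift _ mf f0)) add0r.
  by apply: eq_integral => h _; rewrite add0r.
rewrite le_eqVlt => /predU1P[<-|b0] mf f0.
  rewrite addr0; apply: eq_integral => g _.
  by rewrite integral_gauss0 ?addr0//; apply: measurableT_comp => //; exact: measurable_funD.
have mp (w : R) : measurable_fun setT (normal_pdf 0 w) by exact: measurable_normal_pdf.
have pge w x : 0 <= normal_pdf 0 w x by exact: normal_pdf_ge0.
pose K z := (f z.2 * (normal_pdf 0 (Num.sqrt b) (z.2 - z.1))%:E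
  * (normal_pdf 0 (Num.sqrt a) z.1)%:E)%E.
have mK : measurable_fun setT K.
  apply: emeasurable_funM; [apply: emeasurable_funM|].
  - exact: measurableT_comp.
  - apply/measurable_EFinP; apply: measurableT_comp => //; exact: measurable_funB.
  - by apply/measurable_EFinP; apply: measurableT_comp.
have K0 z : (0 <= K z)%E by rewrite /K !mule_ge0// lee_fin.
have mfD g : measurable_fun setT (fun h => f (g + h)).
  by apply: measurableT_comp => //; exact: measurable_funD.
have mKg g : measurable_fun setT
    (fun u => f u * (normal_pdf 0 (Num.sqrt b) (u - g)%R)%:E)%E.
  apply: emeasurable_funM => //; apply/measurable_EFinP.
  by apply: measurableT_comp => //; exact: measurable_funB.
have Kg0 g u : (0 <= f u * (normal_pdf 0 (Num.sqrt b) (u - g)%R)%:E)%E.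
  by rewrite mule_ge0// lee_fin.
have inner g : (\int[gauss b]_h f (g + h)%R =
    \int[mu]_u (f u * (normal_pdf 0 (Num.sqrt b) (u - g)%R)%:E))%E.
  rewrite (integral_gauss b0 (mfD g)); last by move=> x; exact: f0.
  rewrite (ge0_integral_translation g (mKg g) (Kg0 g)).
  by apply: eq_integral => x _; rewrite addrK (addrC g).
rewrite (integral_gauss a0 (measurable_integral_shift _ mf f0)); last first.
  by move=> g; apply: integral_ge0 => h _; exact: f0.
transitivity (\int[mu]_g \int[mu]_u K (g, u))%E.
  apply: eq_integral => g _; rewrite inner -(ge0_integralZr mu measurableT (mKg g))//=.
  by rewrite lee_fin.
rewrite fubini_tonelli// integral_gauss ?addr_gt0//.
apply: eq_integral => u _; rewrite /K/=.
under eq_integral => g _.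
  rewrite -muleA -EFinM mulrC normal_pdf_mul// EFinM muleA.
  over.
rewrite ge0_integralZl//=.
- by rewrite integral_normal_pdf mule1.
- by apply/measurable_EFinP; exact: measurable_normal_pdf.
- by move=> x _; rewrite lee_fin normal_pdf_ge0.
- by rewrite mule_ge0// lee_fin.
Qed.

End gauss.

Section gauss_moments.
Context {R : realType}.
Notation mu := (@lebesgue_measure R).
Implicit Types (c v x : R).

Let mpdf m v : measurable_fun setT (fun x => (normal_pdf m (Num.sqrt v) x)%:E).
Proof. by apply/measurable_EFinP; exact: measurable_normal_pdf. Qed.

(** When [f] turns the density into a multiple of another normal density, the
  integral of [f] is read off the total mass of the latter. *)
Let integral_tilted v (f : R -> R) k m w : 0 < v -> measurable_fun setT f ->
  (forall x, 0 <= f x) -> 0 <= k ->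
  (forall x, f x * normal_pdf 0 (Num.sqrt v) x = k * normal_pdf m (Num.sqrt w) x) ->
  (\int[gauss v]_x (f x)%:E = k%:E)%E.
Proof.
move=> v0 mf f0 k0 fE.
rewrite integral_gauss//; last exact/measurable_EFinP.
under eq_integral => x _ do rewrite -EFinM fE EFinM.
rewrite (ge0_integralZl mu measurableT (mpdf _ _)).
- by rewrite integral_normal_pdf mule1.
- by move=> x _; rewrite lee_fin normal_pdf_ge0.
- by rewrite lee_fin.
Qed.

Lemma gauss_expR_lty v : 0 <= v -> (\int[gauss v]_x (expR x)%:E < +oo)%E.
Proof.
have mexp : measurable_fun setT (@expR R) by exact: measurable_expR.
rewrite le_eqVlt => /predU1P[<-|v0].
  by rewrite integral_gauss0 ?ltry//; exact/measurable_EFinP.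
rewrite (@integral_tilted v expR (expR (v / 2)) v v)// ?ltry//.
move=> x; rewrite !normal_pdf_varE// mulrCA [RHS]mulrCA -!expRD.
by congr (_ * expR _); field; rewrite gt_eqF.
Qed.

Lemma gauss_expR_sqr v r : 0 < v -> 0 < r ->
  (\int[gauss v]_x (expR (- ((1 - r ^+ 2) / (2 * v * r ^+ 2) * x ^+ 2)))%:E = r%:E)%E.
Proof.
move=> v0 r0; apply: (@integral_tilted v _ r 0 (v * r ^+ 2)) => //.
- apply: measurableT_comp => //; apply: measurableT_comp => //.
  by apply: measurable_funM => //; exact: measurable_funX.
- exact: ltW.
move=> x; rewrite !normal_pdf_varE ?mulr_gt0 ?exprn_gt0//.
have -> : (Num.sqrt (2 * pi * (v * r ^+ 2)))^-1 = r^-1 * (Num.sqrt (2 * pi * v))^-1.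
  rewrite mulrA sqrtrM ?mulr_ge0 ?pi_ge0 ?(ltW v0)//.
  by rewrite sqrtr_sqr gtr0_norm// invfM mulrC.
rewrite -(mulrA r^-1) (mulrA r) divff ?gt_eqF// mul1r mulrCA -expRD.
by congr (_ * expR _); field; rewrite !gt_eqF.
Qed.

(** Since [1 - m * x ^+ 2 <= expR (- (m * x ^+ 2))], the second moment is at least
  [(1 - r) / m], where [r] is the integral of the right-hand side. By
  [gauss_expR_sqr] this quotient is [2 * v * r ^+ 2 / (1 + r)], which tends to [v] as
  [r] tends to [1]. *)
Lemma gauss_second_moment_ge v : 0 <= v -> (v%:E <= \int[gauss v]_x (x ^+ 2)%:E)%E.
Proof.
have msq : measurable_fun setT (fun x : R => x ^+ 2) by exact: measurable_funX.
rewrite le_eqVlt => /predU1P[<-|v0].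
  by apply: integral_ge0 => x _; rewrite lee_fin sqr_ge0.
apply/lee_mul01Pr; first by rewrite lee_fin ltW.
move=> q /andP[q0 q1]; rewrite -EFinM.
(* any [r < 1] with [q * (1 + r) <= 2 * r ^+ 2] would do *)
pose r := (1 + q) / 2; pose m := (1 - r ^+ 2) / (2 * v * r ^+ 2).
have r0 : 0 < r by rewrite /r; lra.
have r1 : r < 1 by rewrite /r; lra.
have m0 : 0 < m.
  apply: divr_gt0.
    by rewrite subr_gt0 expr_lt1// ltW.
  by apply: mulr_gt0; [exact: mulr_gt0|exact: exprn_gt0].
set M := (\int[gauss v]_x (x ^+ 2)%:E)%E.
have M0 : (0 <= M)%E by apply: integral_ge0 => x _; rewrite lee_fin sqr_ge0.
have : (1 <= r%:E + m%:E * M)%E.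
  have mmsq : measurable_fun setT (fun x => (m%:E * (x ^+ 2)%:E)%E).
    by apply/measurable_EFinP; exact: measurable_funM.
  have mexp : measurable_fun setT (fun x => (expR (- (m * x ^+ 2)))%:E).
    apply/measurable_EFinP; apply: measurableT_comp => //.
    by apply: measurableT_comp => //; exact: measurable_funM.
  rewrite -(gauss_expR_sqr v0 r0) -/m -ge0_integralZl ?lee_fin ?(ltW m0)//; last 2 first.
  - exact/measurable_EFinP.
  - by move=> x _; rewrite lee_fin sqr_ge0.
  rewrite -(ge0_integralD (gauss v) measurableT _ mexp _ mmsq)//; last first.
    by move=> x _; rewrite -EFinM lee_fin mulr_ge0 ?sqr_ge0 ?(ltW m0).
  rewrite -(@probability_setT _ _ _ (gauss v)) -[X in (X <= _)%E]mul1e -integral_cst//.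
  apply: ge0_le_integral => //; first exact: emeasurable_funD.
  move=> x _; rewrite -EFinM -EFinD lee_fin.
  have := expR_ge1Dx (- (m * x ^+ 2)); lra.
case: M M0 => [M| |] M0; [|by move=> _; rewrite leey|by []].
rewrite -EFinM -EFinD !lee_fin => h.
rewrite -(ler_pM2l m0); apply: (@le_trans _ _ (1 - r)); last by lra.
have -> : m * (q * v) = (1 - r) * ((1 + r) * q / (2 * r ^+ 2)).
  by rewrite /m; field; rewrite !gt_eqF.
apply: ler_piMr; first by rewrite subr_ge0 ltW.
have r2 : 0 < 2 * r ^+ 2 by apply: mulr_gt0 => //; exact: exprn_gt0.
rewrite (ler_pdivrMr _ _ r2) mul1r /r; nra.
Qed.

Lemma gauss_tail_gt0 v c : 0 < v -> (0 < gauss v `[c, +oo[%classic)%E.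
Proof.
move=> v0; rewrite gauss.unlock gt_eqF//= /normal_prob.
pose m := `|c|; pose p := normal_pdf 0 (Num.sqrt v) (m + 1).
have p0 : 0 < p.
  by rewrite /p normal_pdf_varE// mulr_gt0 ?expR_gt0// invr_gt0 sqrtr_gt0 !mulr_gt0 ?pi_gt0.
apply: (@lt_le_trans _ _ p%:E); first by rewrite lte_fin.
apply: (@le_trans _ _ (\int[mu]_(x in `[m, (m + 1)%R]) (normal_pdf 0%R (Num.sqrt v) x)%:E)%E); last first.
  apply: ge0_subset_integral => //.
  - by apply: measurable_funTS; exact: mpdf.
  - by move=> x _; rewrite lee_fin normal_pdf_ge0.
  - move=> x /=; rewrite !in_itv/= andbT => /andP[mx _].
    by apply: le_trans mx; rewrite ler_norm.
have -> : p%:E = (\int[mu]_(x in `[m, (m + 1)%R]) p%:E)%E.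
  rewrite integral_cst//= lebesgue_measure_itv/= lte_fin ltrDl ltr01 -EFinD.
  by rewrite (addrC m) addrK mule1.
apply: ge0_le_integral => //.
- by move=> x _; rewrite lee_fin ltW.
- by apply: measurable_funTS; exact: mpdf.
- move=> x /=; rewrite in_itv/= => /andP[mx xm].
  have m0 : 0 <= m by rewrite normr_ge0.
  rewrite lee_fin /p !normal_pdf_varE// ler_wpM2l ?invr_ge0 ?sqrtr_ge0//.
  rewrite ler_expR lerN2 !subr0 ler_pM2r ?invr_gt0 ?mulr_gt0//.
  by rewrite lerXn2r// nnegrE; lra.
Qed.

End gauss_moments.

(** * Poisson laws *)

Lemma nneseries_addn_shift {R : realType} (h : nat -> \bar R) j :
  (forall k, 0 <= h k)%E ->
  (\sum_(0 <= k <oo) h (k + j)%N = \sum_(j <= m <oo) h m)%E.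
Proof.
move=> h0; apply/cvg_lim => //.
have : cvgn (fun n => \sum_(j <= m < n) h m)%E by apply: is_cvg_nneseries.
rewrite -(cvg_shiftn j).
by under eq_fun => n do rewrite -{1}(add0n j) big_addn addnK.
Qed.

HB.lock Definition pois {R : realType} (th : R) : probability nat R :=
  poisson_prob th 0.

Section poisson.
Context {R : realType}.
Implicit Types (a b th : R) (k : nat).

(** At [th = 0] this is the unit mass at [0], as for [poisson_prob], whereas
  [poisson_pmf 0] is constantly [1]. *)
Definition pois_weight th k : R := th ^+ k / k`!%:R * expR (- th).

Lemma pois_weight_ge0 th k : 0 <= th -> 0 <= pois_weight th k.
Proof. by move=> th0; rewrite !mulr_ge0 ?exprn_ge0 ?invr_ge0 ?expR_ge0. Qed.

Lemma measurable_fun_nat d (T : measurableType d) (f : nat -> T) :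
  measurable_fun setT f.
Proof. by []. Qed.

Lemma integral_pois th (f : nat -> \bar R) : 0 <= th -> (forall k, 0 <= f k)%E ->
  (\int[pois th]_k f k = \sum_(k <oo) ((pois_weight th k)%:E * f k))%E.
Proof.
rewrite le_eqVlt => /predU1P[<-|th0] f0; rewrite pois.unlock.
  rewrite (@eq_measure_integral _ _ _ _ \d_0%N)//=; last first.
    by move=> A mA _; rewrite /poisson_prob ltxx.
  rewrite integral_dirac// diracT mul1e nneseries_recl//; last first.
    by move=> k _; rewrite mule_ge0// lee_fin pois_weight_ge0.
  rewrite /pois_weight expr0 fact0 invr1 mulr1 oppr0 expR0 mulr1 mul1e eseries0 ?adde0//.
  by move=> [|i]// _ _; rewrite expr0n/= !mul0r mul0e.
rewrite (@ge0_integral_density _ _ _ counting _ (pois_weight th))//.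
- rewrite ge0_integral_count; last first.
    by move=> k; rewrite mule_ge0// lee_fin pois_weight_ge0// ltW.
  by apply: eq_eseriesr => k _; rewrite muleC.
- by move=> k; rewrite pois_weight_ge0// ltW.
move=> A mA; rewrite /= /poisson_prob th0 integral_mkcond ge0_integral_count; last first.
  by move=> k; apply: erestrict_ge0 => i _; rewrite lee_fin pois_weight_ge0// ltW.
rewrite esum_mkcond nneseries_esumT//; last first.
  by move=> k; apply: erestrict_ge0 => i _; rewrite lee_fin pois_weight_ge0// ltW.
apply: eq_esum => k _; rewrite patchE.
by rewrite /poisson_pmf th0.
Qed.

(** As [k ^_ j / k`!] is [1 / (k - j)`!], shifting the summation index by [j] leaves
  [th ^+ j] times the total mass. *)
Lemma pois_falling th j : 0 <= th ->
  (\int[pois th]_k (k ^_ j)%:R%:E = (th ^+ j)%:E)%E.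
Proof.
move=> th0; rewrite integral_pois//.
have h0 k : (0 <= (pois_weight th k)%:E * (k ^_ j)%:R%:E)%E.
  by rewrite mule_ge0 ?lee_fin ?pois_weight_ge0.
rewrite (nneseries_split 0 j)//.
rewrite add0n big1_seq ?add0e; last first.
  move=> k /=; rewrite mem_index_iota => /andP[_ kj].
  by rewrite ffact_small// mule0.
rewrite -(nneseries_addn_shift j h0)//.
transitivity (\sum_(0 <= k <oo) ((th ^+ j)%:E * (pois_weight th k)%:E))%E.
  apply: eq_eseriesr => k _; rewrite -!EFinM; congr EFin.
  rewrite /pois_weight exprD mulrA.
  have := @ffact_fact (k + j) j (leq_addl _ _); rewrite addnK => <-.
  rewrite natrM; field; rewrite !pnatr_eq0 -!lt0n fact_gt0.
  by rewrite ffact_gt0 leq_addl.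
rewrite nneseriesZl//; last by move=> k _; rewrite lee_fin pois_weight_ge0.
rewrite [X in (_ * X)%E](_ : _ = 1%E) ?mule1//.
transitivity (\int[pois th]_k (cst 1%E k))%E.
  rewrite integral_pois//.
  by apply: eq_eseriesr => k _; rewrite /cst mule1.
by rewrite integral_cst// mul1e; exact: probability_setT.
Qed.

(** Separating positive and negative coefficients turns the hypothesis into an
  inequality between sums of nonnegative terms, so [F] may have infinite mean. *)
Lemma pois_falling_minorant th n (c : nat -> R) (F : nat -> R) : 0 <= th ->
  (forall k, 0 <= F k) ->
  (forall k, \sum_(j < n) c j * (k ^_ j)%:R <= F k) ->
  ((\sum_(j < n) c j * th ^+ j)%:E <= \int[pois th]_k (F k)%:E)%E.
Proof.
move=> th0 F0 cF.
pose p j := Num.max (c j) 0; pose m j := Num.max (- c j) 0.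
have p0 j : 0 <= p j by rewrite le_max lexx orbT.
have m0 j : 0 <= m j by rewrite le_max lexx orbT.
have cE j : c j = p j - m j.
  by rewrite /p /m; have [c0|c0] := leP (c j) 0; case: leP; lra.
have sumE (q : nat -> R) : (forall j, 0 <= q j) ->
    (\int[pois th]_k (\sum_(j < n) q j * (k ^_ j)%:R)%:E = (\sum_(j < n) q j * th ^+ j)%:E)%E.
  move=> q0; under eq_integral do rewrite -sumEFin.
  rewrite ge0_integral_sum//; last by move=> j k _; rewrite lee_fin mulr_ge0.
  rewrite -sumEFin; apply: eq_bigr => j _.
  under eq_integral do rewrite EFinM.
  by rewrite ge0_integralZl ?pois_falling// lee_fin.
have : (\int[pois th]_k (\sum_(j < n) p j * (k ^_ j)%:R)%:E <=
    \int[pois th]_k (F k)%:E + \int[pois th]_k (\sum_(j < n) m j * (k ^_ j)%:R)%:E)%E.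
  rewrite -ge0_integralD//; last 2 first.
  - by move=> k _; rewrite lee_fin.
  - by move=> k _; rewrite lee_fin sumr_ge0// => j _; rewrite mulr_ge0.
  apply: ge0_le_integral => //.
  - by move=> k _; rewrite lee_fin sumr_ge0// => j _; rewrite mulr_ge0.
  - move=> k _; rewrite -EFinD lee_fin -lerBlDr -sumrB.
    apply: le_trans (cF k); rewrite le_eqVlt; apply/orP; left; apply/eqP.
    by apply: eq_bigr => j _; rewrite cE mulrBl.
rewrite !sumE// -leeBlDr// -EFinB -sumrB.
apply: le_trans; rewrite lee_fin le_eqVlt; apply/orP; left; apply/eqP.
by apply: eq_bigr => j _; rewrite cE mulrBl.
Qed.

Lemma pois_weight_conv a b m :
  \sum_(j < m.+1) pois_weight a j * pois_weight b (m - j)%N = pois_weight (a + b) m.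
Proof.
rewrite /pois_weight opprD expRD addrC exprDn mulr_suml mulr_suml.
apply: eq_bigr => j _; have jm : (j <= m)%N by rewrite -ltnS.
rewrite -(bin_fact jm) !natrM -[_ *+ 'C(_, _)]mulr_natr.
field; rewrite !pnatr_eq0 -!lt0n !fact_gt0 bin_gt0 jm//.
Qed.

Lemma pois_conv a b (F : nat -> \bar R) : 0 <= a -> 0 <= b ->
  (forall k, 0 <= F k)%E ->
  (\int[pois a]_j \int[pois b]_k F (j + k)%N = \int[pois (a + b)]_k F k)%E.
Proof.
move=> a0 b0 F0.
rewrite integral_pois//; last by move=> j; exact: integral_ge0.
rewrite integral_pois ?addr_ge0//.
have pw0 th k : 0 <= th -> (0 <= (pois_weight th k)%:E)%E.
  by move=> ?; rewrite lee_fin pois_weight_ge0.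
pose G j m := (if (j <= m)%N then
  (pois_weight a j)%:E * ((pois_weight b (m - j))%:E * F m) else 0)%E.
have G0 j m : (0 <= G j m)%E.
  by rewrite /G; case: ifP => // _; rewrite !mule_ge0 ?pw0.
transitivity (\sum_(j <oo) \sum_(m <oo) G j m)%E.
  apply: eq_eseriesr => j _; rewrite integral_pois//.
  rewrite -nneseriesZl//; last by move=> k _; rewrite mule_ge0 ?pw0.
  rewrite [RHS](nneseries_split 0 j)// add0n [X in (X + _)%E]big1_seq ?add0e; last first.
    move=> k /=; rewrite mem_index_iota => /andP[_ kj].
    by rewrite /G leqNgt kj.
  rewrite -(nneseries_addn_shift j (G0 j)).
  by apply: eq_eseriesr => k _; rewrite /G leq_addl addnK (addnC k).
rewrite nneseries_interchange//; apply: eq_eseriesr => m _.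
rewrite (nneseries_split 0 m.+1)// add0n [X in (_ + X)%E]eseries0 ?adde0; last first.
  by move=> j mj _; rewrite /G leqNgt mj.
rewrite big_mkord -pois_weight_conv -sumEFin ge0_sume_distrl; last first.
  by move=> j _; rewrite lee_fin mulr_ge0 ?pois_weight_ge0.
by apply: eq_bigr => j _; rewrite /G -ltnS ltn_ord EFinM muleA.
Qed.

End poisson.

(** * Third moments of Gaussian-Poisson sums *)

Section lower_bound.
Context {R : realType}.
Implicit Types (a b c g p q th v x y : R).

Lemma measurable_pospart : measurable_fun setT (@pospart R).
Proof. exact: measurable_maxr. Qed.

Lemma measurable_cube_pos : measurable_fun setT (@cube_pos R).
Proof. by apply: measurable_funX; exact: measurable_pospart. Qed.

Lemma pospartM y x : 0 <= y -> pospart (y * x) = y * pospart x.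
Proof. by move=> y0; rewrite /pospart maxr_pMr// mulr0. Qed.

Lemma cube_posM y x : 0 <= y -> cube_pos (y * x) = y ^+ 3 * cube_pos x.
Proof. by move=> y0; rewrite /cube_pos pospartM// exprMn. Qed.

Lemma jump_termM y c : 0 <= y -> jump_term y (y * c) = y ^+ 3 * jump_term 1 c.
Proof.
move=> y0; rewrite /jump_term -{2}(mulr1 y) -mulrDr !cube_posM// pospartM//; ring.
Qed.

Lemma natr_ffact2 (k : nat) : (k ^_ 2)%:R = k%:R ^+ 2 - k%:R :> R.
Proof.
case: k => [|k]; first by rewrite expr0n/= subr0.
by rewrite ffactnS ffactn1 natrM/= -natr1; ring.
Qed.

Lemma natr_ffact3 (k : nat) :
  (k ^_ 3)%:R = k%:R ^+ 3 - 3 * k%:R ^+ 2 + 2 * k%:R :> R.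
Proof.
case: k => [|[|k]]; rewrite ?ffactnS ?ffactn1 ?natrM/=; [ring|ring|].
by rewrite -!natr1; ring.
Qed.

(** The Poisson half of the lower bound: after rescaling to jumps of size [1], take
  the mean of the cubic minorant. *)
Lemma pois_cube_pos_ge y th c : 0 < y -> 0 <= th ->
  ((cube_pos c + th * jump_term y c)%:E <=
   \int[pois th]_k (cube_pos (c + y * (k%:R - th)))%:E)%E.
Proof.
move=> y0 th0; have y0' := ltW y0; pose w := - (c / y).
have cE : c = y * - w by rewrite /w; field; rewrite gt_eqF.
have [c0 [c1 [c2 [c3 [minor mean]]]]] := cube_pos_cubic_minorant w.
(* the cubic in [k - th], written in the falling factorials of [k] *)
pose d j := match j with
  | 0%N => c0 - c1 * th + c2 * th ^+ 2 - c3 * th ^+ 3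
  | 1%N => c1 + c2 * (1 - 2 * th) + c3 * (1 - 3 * th + 3 * th ^+ 2)
  | 2%N => c2 + c3 * (3 - 3 * th)
  | _ => c3 end.
have -> : cube_pos c + th * jump_term y c = \sum_(j < 4) (y ^+ 3 * d j) * th ^+ j.
  rewrite {1 2}cE cube_posM// jump_termM//.
  transitivity (y ^+ 3 * (cube_pos (- w) + th * jump_term 1 (- w))); first by ring.
  rewrite -mean//.
  by rewrite !big_ord_recl big_ord0 /= /bump/=; ring.
apply: (@pois_falling_minorant _ th 4 (fun j => y ^+ 3 * d j)) => // [k|k].
  exact: cube_pos_ge0.
have -> : c + y * (k%:R - th) = y * ((k%:R - th) - w) by rewrite {1}cE; ring.
rewrite cube_posM//; under eq_bigr do rewrite -mulrA.
rewrite -mulr_sumr ler_pM2l ?exprn_gt0//; apply: le_trans (minor _).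
rewrite le_eqVlt; apply/orP; left; apply/eqP.
by rewrite !big_ord_recl big_ord0 /= /bump/= ffactn0 ffactn1 natr_ffact2 natr_ffact3; ring.
Qed.

(** The mean of [cube_pos (g + y * (k - th) + c)] for independent [g], [k] of laws
  [gauss v] and [pois th]; as a function of [c] and of the parameters this is a
  convolution semigroup. *)
Definition cube_moment y v th c : \bar R :=
  (\int[gauss v]_g \int[pois th]_k (cube_pos (g + y * (k%:R - th) + c))%:E)%E.

Lemma measurable_pois_integral y th (f : R -> \bar R) :
  measurable_fun setT f -> (forall x, 0 <= f x)%E ->
  measurable_fun setT (fun x => \int[pois th]_k f (x + y * (k%:R - th))%R)%E.
Proof.
move=> mf f0.
pose f2 (z : measurableTypeR R * nat) := f (z.1 + y * (z.2%:R - th)).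
have mf2 : measurable_fun setT f2.
  apply: measurableT_comp => //; apply: measurable_funD => //.
  exact: (measurableT_comp (measurable_fun_nat (fun k : nat => y * (k%:R - th))) measurable_snd).
have f20 z : (0 <= f2 z)%E by exact: f0.
exact: (@measurable_fun_fubini_tonelli_F _ _ _ _ _ (pois th) f2 mf2 f20).
Qed.

(** The cube plus its image under the generator of the semigroup [cube_moment]:
  half of [v] times the second derivative, plus [th] times the jump term. *)
Definition taylor_bound y v th c : R :=
  cube_pos c + 3 * pospart c * v + th * jump_term y c.

(** A semigroup [exp (s L)] satisfies [f + L f <= exp L f] as soon as [L f] is
  convex and the underlying process is centred, by Jensen's inequality for [L f].
  Here the Poisson part is integrated first; what it leaves, [h], is a sum of the
  cube and a convex function, and the symmetry and the variance of the normal law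
  supply the remaining term. *)
Lemma taylor_bound_le_cube_moment y v th c : 0 < y -> 0 <= v -> 0 <= th ->
  ((taylor_bound y v th c)%:E <= cube_moment y v th c)%E.
Proof.
move=> y0 v0 th0; pose h x := cube_pos x + th * jump_term y x.
have h0 x : 0 <= h x.
  by rewrite addr_ge0 ?cube_pos_ge0// mulr_ge0// jump_term_ge0// ltW.
have mh : measurable_fun setT h.
  apply: measurable_funD; first exact: measurable_cube_pos.
  apply: measurable_funM => //; apply: measurable_funB.
    apply: measurable_funB; last exact: measurable_cube_pos.
    by apply: measurableT_comp; [exact: measurable_cube_pos|exact: measurable_funD].
  apply: measurable_funM => //; apply: measurable_funM => //.
  by apply: measurable_funX; exact: measurable_pospart.
have mhc : measurable_fun setT (fun x => (h (c + x))%:E).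
  by apply/measurable_EFinP; apply: measurableT_comp => //; exact: measurable_funD.
have mhN : measurable_fun setT (fun x => (h (c - x))%:E).
  by apply/measurable_EFinP; apply: measurableT_comp => //; exact: measurable_funB.
have hlow : (\int[gauss v]_g (h (c + g))%:E <= cube_moment y v th c)%E.
  apply: ge0_le_integral => //.
  - by move=> x _; rewrite lee_fin.
  - under eq_fun do under eq_integral do rewrite addrAC.
    have mcc : measurable_fun setT (fun x : R => x + c) by exact: measurable_funD.
    have mcub : measurable_fun setT (fun x : R => (cube_pos x)%:E).
      by apply/measurable_EFinP; exact: measurable_cube_pos.
    have cub0 x : (0 <= (cube_pos x)%:E)%E by rewrite lee_fin cube_pos_ge0.
    exact: (measurableT_comp (measurable_pois_integral y th mcub cub0) mcc).
  - move=> g _; apply: le_trans (pois_cube_pos_ge _ y0 th0) _.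
    by under [leRHS]eq_integral do rewrite addrAC (addrC g).
apply: le_trans hlow.
have M := gauss_second_moment_ge v0.
have msq : measurable_fun setT (fun x : R => x ^+ 2) by exact: measurable_funX.
have mid : ((2 * h c + 6 * pospart c * v)%:E <=
    \int[gauss v]_g (h (c + g))%:E + \int[gauss v]_g (h (c - g))%:E)%E.
  rewrite -(ge0_integralD (gauss v) measurableT _ mhc _ mhN); last 2 first.
  - by move=> x _; rewrite lee_fin h0.
  - by move=> x _; rewrite lee_fin h0.
  apply: (@le_trans _ _ (\int[gauss v]_g (2 * h c + 6 * pospart c * g ^+ 2)%:E)%E).
    have pc0 : 0 <= 6 * pospart c by rewrite mulr_ge0// pospart_ge0.
    under eq_integral do rewrite EFinD.
    rewrite (ge0_integralD (gauss v) measurableT)//; last 3 first.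
    - by move=> x _; rewrite lee_fin mulr_ge0.
    - by move=> x _; rewrite lee_fin mulr_ge0 ?sqr_ge0.
    - by apply/measurable_EFinP; exact: measurable_funM.
    rewrite integral_cst//. rewrite [X in (_ * X)%E](_ : _ = 1%E) ?mule1; last exact: probability_setT.
    rewrite EFinD leeD2l//.
    under eq_integral do rewrite EFinM.
    rewrite (ge0_integralZl (gauss v) measurableT)//; last 2 first.
    - exact/measurable_EFinP.
    - by move=> x _; rewrite lee_fin sqr_ge0.
    by rewrite EFinM lee_wpmul2l// lee_fin.
  apply: ge0_le_integral => //.
  - move=> x _; rewrite lee_fin; apply: addr_ge0; first exact: mulr_ge0.
    by apply: mulr_ge0 (sqr_ge0 _); rewrite mulr_ge0// pospart_ge0.
  - by apply/measurable_EFinP; apply: measurable_funD => //; exact: measurable_funM.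
  - exact: emeasurable_funD.
  - move=> g _; rewrite -EFinD lee_fin /h.
    have := cube_pos_midpoint c g.
    have := ler_wpM2l th0 (jump_term_midpoint c g (ltW y0)); lra.
have sym : (\int[gauss v]_g (h (c - g))%:E = \int[gauss v]_g (h (c + g))%:E)%E.
  by apply: (ge0_integral_gauss_sym v0 mhc) => x; rewrite lee_fin.
move: mid; rewrite sym.
have -> : 2 * h c + 6 * pospart c * v = 2 * taylor_bound y v th c.
  by rewrite /taylor_bound /h; ring.
case: (\int[gauss v]_g (h (c + g))%:E)%E => [r| |]; rewrite ?leey//.
by rewrite -EFinD !lee_fin; lra.
Qed.

(** Normal and Poisson laws are stable under convolution; Fubini's theorem brings
  the two normal and the two Poisson integrals together. *)
Lemma cube_moment_conv y a b p q c : 0 <= a -> 0 <= b -> 0 <= p -> 0 <= q ->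
  (\int[gauss a]_g \int[pois p]_j cube_moment y b q (g + y * (j%:R - p) + c)%R =
   cube_moment y (a + b) (p + q) c)%E.
Proof.
move=> a0 b0 p0 q0.
pose f x := (cube_pos x)%:E.
have mf : measurable_fun setT f by apply/measurable_EFinP; exact: measurable_cube_pos.
have f0 x : (0 <= f x)%E by rewrite lee_fin cube_pos_ge0.
pose Psi x := (\int[pois q]_k f (x + y * (k%:R - q))%R)%E.
have mPsi : measurable_fun setT Psi by exact: measurable_pois_integral.
have Psi0 x : (0 <= Psi x)%E by exact: integral_ge0.
pose H x := (\int[pois p]_j Psi ((x + c) + y * (j%:R - p))%R)%E.
have mH : measurable_fun setT H.
  apply: (measurableT_comp (measurable_pois_integral y p mPsi Psi0)).
  exact: measurable_funD.
have H0 x : (0 <= H x)%E by exact: integral_ge0.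
transitivity (\int[gauss a]_g \int[gauss b]_h H (g + h)%R)%E.
  apply: eq_integral => g _.
  pose K (z : nat * measurableTypeR R) := Psi (g + z.2 + c + y * (z.1%:R - p)).
  have mK : measurable_fun setT K.
    apply: measurableT_comp => //; apply: measurable_funD.
      by apply: measurable_funD => //; exact: measurable_funD.
    exact: (measurableT_comp (measurable_fun_nat (fun k : nat => y * (k%:R - p))) measurable_fst).
  have K0 z : (0 <= K z)%E by exact: Psi0.
  transitivity (\int[pois p]_j \int[gauss b]_h K (j, h))%E.
    apply: eq_integral => j _; apply: eq_integral => h _; apply: eq_integral => k _.
    by congr f; rewrite /=; ring.
  by rewrite (fubini_tonelli K mK K0).
rewrite gauss_conv//; apply: eq_integral => x _.
pose F m := f (x + y * (m%:R - (p + q)) + c).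
transitivity (\int[pois p]_j \int[pois q]_k F (j + k)%N)%E.
  apply: eq_integral => j _; apply: eq_integral => k _.
  by rewrite /F natrD; congr f; ring.
by apply: pois_conv => // k; exact: f0.
Qed.

End lower_bound.

(** * Joint laws and partial sums of independent variables *)

Section independence.
Context d (T : measurableType d) (R : realType) (P : probability T R).

(** The event [C] stands for the variables that have not been summed yet. If
  [P C] is positive, rescaling the restriction of [P] to [C] gives a measure which
  agrees with the product of the laws on rectangles, hence everywhere. *)
Lemma joint_distribution d1 d2 (T1 : measurableType d1) (T2 : measurableType d2)
    (Z : {RV P >-> T1}) (W : {RV P >-> T2}) (C : set T) : measurable C ->
  (forall A B, measurable A -> measurable B ->
    P (Z @^-1` A `&` W @^-1` B `&` C) = (P (Z @^-1` A) * P (W @^-1` B) * P C)%E) ->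
  forall E, measurable E ->
    P ((fun w => (Z w, W w)) @^-1` E `&` C) =
    ((distribution P Z \x distribution P W) E * P C)%E.
Proof.
move=> mC ZWC E mE.
have mZW : measurable_fun setT (fun w => (Z w, W w)) by exact: measurable_fun_pair.
have [PC0|PC0] := eqVneq (P C) 0%E.
  rewrite PC0 mule0; apply/eqP; rewrite eq_le measure_ge0 andbT -PC0.
  have mEC : measurable ((fun w => (Z w, W w)) @^-1` E `&` C).
    by apply: measurableI => //; rewrite -[X in measurable X]setTI; exact: mZW.
  by apply: le_measure; rewrite ?inE//; exact: subIsetr.
have PCfin : P C \is a fin_num by exact: fin_num_measure.
have c0 : 0 <= (fine (P C))^-1 by rewrite invr_ge0 fine_ge0.
pose m' := mscale (NngNum c0) (pushforward (mrestr P mC) (fun w => (Z w, W w))).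
have PCE : P C = (fine (P C))%:E by rewrite fineK.
have fPC : fine (P C) != 0 by rewrite -eqe -PCE.
rewrite (@product_measure_unique _ _ _ _ _ _ _ (m' mZW))//.
  rewrite /m' /= /mscale/= /pushforward /mrestr.
  rewrite muleAC {2}PCE -EFinM mulVf// mul1e//.
move=> A B mA mB; rewrite /m' /= /mscale/= /pushforward /mrestr.
have -> : (fun w => (Z w, W w)) @^-1` (A `*` B) = Z @^-1` A `&` W @^-1` B by [].
by rewrite ZWC// {2}PCE muleC -muleA -EFinM divff// mule1.
Qed.

Lemma integral_independent2 d1 d2 (T1 : measurableType d1) (T2 : measurableType d2)
    (Z : {RV P >-> T1}) (W : {RV P >-> T2}) (f : T1 * T2 -> \bar R) :
  independent2 P Z W -> measurable_fun setT f -> (forall z, 0 <= f z)%E ->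
  (\int[P]_w f (Z w, W w) =
   \int[distribution P Z]_z \int[distribution P W]_w f (z, w))%E.
Proof.
move=> ZW mf f0.
have mZW : measurable_fun setT (fun w => (Z w, W w)) by exact: measurable_fun_pair.
transitivity (\int[pushforward P (fun w => (Z w, W w))]_z f z)%E.
  by rewrite ge0_integral_pushforward.
rewrite -fubini_tonelli1//; apply: eq_measure_integral => E mE _.
have ZWT A B : measurable A -> measurable B ->
    P (Z @^-1` A `&` W @^-1` B `&` setT) = (P (Z @^-1` A) * P (W @^-1` B) * P setT)%E.
  by move=> mA mB; rewrite setIT probability_setT mule1; exact: ZW.
have := joint_distribution measurableT ZWT mE.
by rewrite setIT probability_setT mule1.
Qed.

End independence.

Section partial_sums.
Context d (T : measurableType d) (R : realType) (P : probability T R).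
Variables (n : nat) (X : 'I_n -> {RV P >-> R}).

Let measurable_partial_sum k :
  measurable_fun setT (fun w => \sum_(i < n | (i < k)%N) X i w).
Proof.
under eq_fun do rewrite big_mkcond/=.
apply: measurable_sum => i /=; case: (i < k)%N; last exact: measurable_cst.
exact: measurable_funP.
Qed.

Definition partial_sum k : {RV P >-> R} :=
  HB.pack (fun w => \sum_(i < n | (i < k)%N) X i w)
    (isMeasurableFun.Build _ _ _ _ _ (measurable_partial_sum k)).

Lemma partial_sum0 w : partial_sum 0 w = 0.
Proof. by rewrite /partial_sum/= big_pred0. Qed.

Lemma partial_sumS (i : 'I_n) w : partial_sum i.+1 w = partial_sum i w + X i w.
Proof.
rewrite /partial_sum/= (bigD1 i)//= addrC; congr (_ + _).
by apply: eq_bigl => j; rewrite ltnS ltn_neqAle andbC.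
Qed.

Lemma partial_sumT w : partial_sum n w = \sum_(i < n) X i w.
Proof. by rewrite /partial_sum/=; apply: eq_bigl => i; rewrite ltn_ord. Qed.

(** Events about the summands from the [k]-th on; the index set is in the form
  required by [mutually_independent]. *)
Let later k (B : 'I_n -> set R) : set T :=
  \bigcap_(i in [set i | i \in [set j : 'I_n | (k <= j)%N]%SET]) (X i @^-1` B i).

Let measurable_later k B : (forall i, measurable (B i)) -> measurable (later k B).
Proof.
move=> mB; apply: fin_bigcap_measurable => //i _.
by rewrite -[X in measurable X]setTI; exact: measurable_funP.
Qed.

Let laterS (i : 'I_n) (B0 : set R) B :
  later i (fun j => if j == i then B0 else B j) = X i @^-1` B0 `&` later i.+1 B.
Proof.
apply/seteqP; split => w.
  move=> h; split.
    by have := h i; rewrite /= inE leqnn eqxx; exact.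
  move=> j /=; rewrite inE => ij; have := h j; rewrite /= inE (ltnW ij).
  by case: eqP ij => [->|_ _]; [rewrite ltnn|exact].
move=> [h0 h] j /=; rewrite inE => ij; case: eqP => [->//|/eqP ji].
by apply: (h j); rewrite /= inE ltn_neqAle ij andbT; apply: contra ji => /eqP/val_inj->.
Qed.

Hypothesis Xindep : mutually_independent P X.

Let later_indep (i : 'I_n) (B0 : set R) B : measurable B0 -> (forall j, measurable (B j)) ->
  P (X i @^-1` B0 `&` later i.+1 B) = (P (X i @^-1` B0) * P (later i.+1 B))%E.
Proof.
move=> mB0 mB; rewrite -laterS /later !Xindep//; last by move=> j; case: ifP.
rewrite (bigD1 i)/=; last by rewrite inE.
rewrite eqxx; congr (_ * _)%E; apply: eq_big => j.
  rewrite !inE ltn_neqAle andbC; congr (_ && _).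
  by rewrite eq_sym.
by move=> /andP[_ /negbTE->].
Qed.

(** Independence of [partial_sum k] and [X k] alone is not inductive; independence
  of [partial_sum k] and the whole block of later variables is. *)
Let partial_sum_joint k : (k <= n)%N -> forall A B, measurable A ->
  (forall i, measurable (B i)) ->
  P (partial_sum k @^-1` A `&` later k B) =
  (P (partial_sum k @^-1` A) * P (later k B))%E.
Proof.
elim: k => [_|k IH kn] A B mA mB.
  have [A0|A0] := pselect (A 0).
    have -> : partial_sum 0 @^-1` A = setT.
      by apply/seteqP; split => // w _; rewrite /preimage /mkset partial_sum0.
    by rewrite setTI probability_setT mul1e.
  have -> : partial_sum 0 @^-1` A = set0.
    by apply/seteqP; split => // w; rewrite /preimage /mkset partial_sum0.
  by rewrite set0I measure0 mul0e.
pose i := Ordinal kn.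
have step C0 (C : 'I_n -> set R) (A' : set R) : measurable A' -> measurable C0 ->
    (forall j, measurable (C j)) ->
    P (partial_sum k @^-1` A' `&` X i @^-1` C0 `&` later k.+1 C) =
    (P (partial_sum k @^-1` A') * P (X i @^-1` C0) * P (later k.+1 C))%E.
  move=> mA' mC0 mC; rewrite -setIA -(laterS i) IH ?(ltnW kn)//; last first.
    by move=> j; case: ifP.
  by rewrite (laterS i) (later_indep i)// muleA.
pose E := [set z : R * R | A (z.1 + z.2)].
have mE : measurable E.
  rewrite -[E]setTI.
  have madd : measurable_fun setT (fun z : R * R => z.1 + z.2) by exact: measurable_funD.
  exact: madd.
have EE : partial_sum k.+1 @^-1` A = (fun w => (partial_sum k w, X i w)) @^-1` E.
  by apply/seteqP; split => w; rewrite /preimage /E /mkset (partial_sumS i).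
have laterT : later k.+1 (fun=> setT) = setT by apply/seteqP; split.
have PE : P (partial_sum k.+1 @^-1` A) =
    (distribution P (partial_sum k) \x distribution P (X i))%E E.
  have := joint_distribution (measurable_later k.+1 (fun=> measurableT))
    (fun A' C0 mA' mC0 => step C0 _ A' mA' mC0 (fun=> measurableT)) mE.
  by rewrite laterT setIT probability_setT mule1 -EE.
rewrite PE EE.
exact: (joint_distribution (measurable_later k.+1 mB)
    (fun A' C0 mA' mC0 => step C0 _ A' mA' mC0 mB) mE).
Qed.

Lemma partial_sum_indep (i : 'I_n) : independent2 P (partial_sum i) (X i).
Proof.
move=> A B mA mB.
have /(_ A (fun j => if j == i then B else setT) mA) := partial_sum_joint (ltnW (ltn_ord i)).
rewrite laterS.
have -> : later i.+1 (fun=> setT) = setT by apply/seteqP; split.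
by rewrite setIT; apply=> j; case: ifP.
Qed.

End partial_sums.

(** * Comparison of third moments *)

Section comparison.
Context d (T : measurableType d) (R : realType) (P : probability T R).
Implicit Types (y c v th : R).

(** Integrate [cube_pos_taylor]. The coefficients of [X], [X ^+ 2] and
  [cube_pos X] are nonnegative, so upper bounds on the three means suffice; with
  [v + y ^+ 2 * th] and [y ^+ 3 * th] in place of the last two, the right-hand side
  regroups into [taylor_bound]. *)
Lemma expectation_cube_pos_le (X : {RV P >-> R}) y v th c s b :
  0 < y -> 0 <= th ->
  {ae P, forall w, X w <= y} ->
  ('E_P[X] <= 0)%E ->
  ('E_P[fun w => (X w ^+ 2)%R] = s%:E)%E ->
  ('E_P[fun w => cube_pos (X w)] = b%:E)%E ->
  s <= v + y ^+ 2 * th -> b <= y ^+ 3 * th ->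
  (\int[P]_w (cube_pos (X w + c))%:E <= (taylor_bound y v th c)%:E)%E.
Proof.
move=> y0 th0 Xy X1 X2 X3 sv bth.
rewrite !unlock in X1 X2 X3.
have mX : measurable_fun setT X by exact: measurable_funP.
have mX2 : measurable_fun setT (fun w => X w ^+ 2) by exact: measurable_funX.
have mX3 : measurable_fun setT (fun w => cube_pos (X w)).
  by apply: measurableT_comp => //; exact: measurable_cube_pos.
have iX2 : P.-integrable setT (fun w => (X w ^+ 2)%:E).
  apply/integrableP; split; first exact/measurable_EFinP.
  under eq_integral do rewrite gee0_abs ?lee_fin ?sqr_ge0//.
  by rewrite X2 ltry.
have iX3 : P.-integrable setT (fun w => (cube_pos (X w))%:E).
  apply/integrableP; split; first exact/measurable_EFinP.
  under eq_integral do rewrite gee0_abs ?lee_fin ?cube_pos_ge0//.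
  by rewrite X3 ltry.
have icst r : P.-integrable setT (fun=> r%:E).
  exact: finite_measure_integrable_cst.
have iX : P.-integrable setT (fun w => (X w)%:E).
  apply: (le_integrable measurableT _ _ (integrableD measurableT (icst 1) iX2)).
    exact/measurable_EFinP.
  move=> w _; rewrite /= lee_fin [leRHS]ger0_norm ?addr_ge0 ?sqr_ge0//.
  by have [x0|x0] := leP 0 (X w); [rewrite ger0_norm//|rewrite ltr0_norm//]; nra.
pose A1 := 3 * pospart c ^+ 2.
pose A2 := 3 * pospart c.
pose A3 := (jump_term y c - 3 * pospart c * y ^+ 2) / y ^+ 3.
have A10 : 0 <= A1 by rewrite mulr_ge0 ?sqr_ge0.
have A20 : 0 <= A2 by rewrite mulr_ge0 ?pospart_ge0.
have A30 : 0 <= A3 by rewrite divr_ge0 ?pospart_jump_term_ge ?exprn_ge0 ?ltW.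
pose B w := cube_pos c + A1 * X w + A2 * X w ^+ 2 + A3 * cube_pos (X w).
have cB w : X w <= y -> cube_pos (X w + c) <= B w.
  move=> Xwy; apply: le_trans (cube_pos_taylor c y0 Xwy) _.
  rewrite /B /A1 /A2 /A3 lerD2l le_eqVlt; apply/orP; left; apply/eqP; ring.
have mB : measurable_fun setT B.
  apply: measurable_funD; last exact: measurable_funM.
  apply: measurable_funD; last exact: measurable_funM.
  by apply: measurable_funD => //; exact: measurable_funM.
have B0 w : 0 <= B w.
  have [Xwy|Xwy] := leP (X w) y; first exact: le_trans (cube_pos_ge0 _) (cB w Xwy).
  have X0 : 0 <= X w by apply: ltW; exact: lt_trans Xwy.
  have h1 := mulr_ge0 A10 X0; have h2 := mulr_ge0 A20 (sqr_ge0 (X w)).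
  have h3 := mulr_ge0 A30 (cube_pos_ge0 (X w)); have h4 := cube_pos_ge0 c.
  rewrite /B; lra.
have BE : (\int[P]_w (B w)%:E = (cube_pos c)%:E + A1%:E * \int[P]_w (X w)%:E +
    A2%:E * s%:E + A3%:E * b%:E)%E.
  rewrite -X2 -X3 -!integralZl//.
  rewrite -[X in (X + _ + _ + _)%E]mule1 -(@probability_setT _ _ _ P) -integral_cst//.
  have j1 := integrableZl measurableT A1 iX.
  have j2 := integrableZl measurableT A2 iX2.
  have j3 := integrableZl measurableT A3 iX3.
  have j01 := integrableD measurableT (icst (cube_pos c)) j1.
  have j012 := integrableD measurableT j01 j2.
  rewrite -(integralD measurableT (icst _) j1) -(integralD measurableT j01 j2).
  by rewrite -(integralD measurableT j012 j3).
apply: (@le_trans _ _ (\int[P]_w (B w)%:E)%E).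
  apply: ae_ge0_le_integral => //.
  - by move=> w _; rewrite lee_fin cube_pos_ge0.
  - apply/measurable_EFinP; apply: measurableT_comp; first exact: measurable_cube_pos.
    exact: measurable_funD.
  - by move=> w _; rewrite lee_fin.
  - exact/measurable_EFinP.
  - by apply: filterS Xy => w Xwy _; rewrite lee_fin cB.
rewrite BE.
have {}X1 : (A1%:E * \int[P]_w (X w)%:E <= 0)%E by rewrite mule_ge0_le0 ?lee_fin.
apply: (@le_trans _ _ ((cube_pos c)%:E + 0 + A2%:E * s%:E + A3%:E * b%:E)%E).
  by rewrite !leeD2r// leeD2l.
rewrite adde0 -!EFinM -!EFinD lee_fin /taylor_bound.
have h2 : A2 * s <= A2 * (v + y ^+ 2 * th) by rewrite ler_wpM2l.
have h3 : A3 * b <= A3 * (y ^+ 3 * th) by rewrite ler_wpM2l.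
have E3 : A3 * (y ^+ 3 * th) = (jump_term y c - 3 * pospart c * y ^+ 2) * th.
  by rewrite /A3; field; rewrite gt_eqF.
rewrite {}E3 in h3.
apply: le_trans (lerD (lerD (lexx (cube_pos c)) h2) h3) _.
rewrite /A2 le_eqVlt; apply/orP; left; apply/eqP; ring.
Qed.

End comparison.

Section sum_comparison.
Context d (T : measurableType d) (R : realType) (P : probability T R).
Implicit Types (a c p y : R).

Lemma measurable_cube_moment y a p : measurable_fun setT (cube_moment y a p).
Proof.
pose f (x : R) := (cube_pos x)%:E.
have mf : measurable_fun setT f by apply/measurable_EFinP; exact: measurable_cube_pos.
have f0 x : (0 <= f x)%E by rewrite lee_fin cube_pos_ge0.
pose Psi x := (\int[pois p]_k f (x + y * (k%:R - p))%R)%E.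
have mPsi : measurable_fun setT Psi by exact: measurable_pois_integral.
have Psi0 x : (0 <= Psi x)%E by exact: integral_ge0.
have -> : cube_moment y a p = fun c => (\int[gauss a]_g Psi (c + g)%R)%E.
  apply/funext => c; apply: eq_integral => g _; apply: eq_integral => k _.
  by rewrite /f; congr (cube_pos _)%:E; ring.
exact: measurable_integral_shift.
Qed.

Lemma cube_moment_ge0 y a p c : (0 <= cube_moment y a p c)%E.
Proof.
by apply: integral_ge0 => g _; apply: integral_ge0 => k _; rewrite lee_fin cube_pos_ge0.
Qed.

(** Replace [S] by a Gaussian-Poisson variable for each fixed value of [X], then
  replace [X] for each fixed value of that variable. The hypotheses are applied with
  shifted [c], which is why they have to hold for all [c]. *)
Lemma add_independent_le_cube_moment (S X : {RV P >-> R}) y a b p q :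
  0 < y -> 0 <= a -> 0 <= b -> 0 <= p -> 0 <= q ->
  independent2 P S X ->
  (forall c, \int[P]_w (cube_pos (S w + c))%:E <= cube_moment y a p c)%E ->
  (forall c, \int[P]_w (cube_pos (X w + c))%:E <= (taylor_bound y b q c)%:E)%E ->
  forall c, (\int[P]_w (cube_pos (S w + X w + c))%:E <= cube_moment y (a + b) (p + q) c)%E.
Proof.
move=> y0 a0 b0 p0 q0 SX hS hX c.
pose f (x : R) := (cube_pos x)%:E.
have mf : measurable_fun setT f by apply/measurable_EFinP; exact: measurable_cube_pos.
have f0 x : (0 <= f x)%E by rewrite lee_fin cube_pos_ge0.
have madd (r : R) : measurable_fun setT (fun x : R => x + r) by exact: measurable_funD.
pose mu := distribution P X.
pose F (z : R * R) := f (z.1 + z.2 + c).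
have mF : measurable_fun setT F.
  by apply: measurableT_comp => //; apply: measurable_funD => //; exact: measurable_funD.
have F0 z : (0 <= F z)%E by exact: f0.
rewrite (integral_independent2 SX mF F0) (fubini_tonelli F mF F0).
pose Psi x := (\int[pois p]_j f (x + y * (j%:R - p))%R)%E.
have mPsi : measurable_fun setT Psi by exact: measurable_pois_integral.
have Psi0 x : (0 <= Psi x)%E by exact: integral_ge0.
apply: (@le_trans _ _ (\int[mu]_x cube_moment y a p (x + c)%R)%E).
  apply: ge0_le_integral => //.
  - by move=> x _; exact: integral_ge0.
  - exact: measurable_fun_fubini_tonelli_G.
  - exact: (measurableT_comp (measurable_cube_moment y a p) (madd c)).
  - move=> x _; apply: le_trans (hS (x + c)).
    rewrite /F/= (@ge0_integral_distribution _ _ _ _ _ _ S (fun s => f (s + x + c)))//=.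
      by under eq_integral do rewrite -addrA.
    by apply: measurableT_comp => //; apply: measurable_funD => //.
pose K (z : R * measurableTypeR R) := Psi (z.2 + (z.1 + c)).
have mK : measurable_fun setT K.
  apply: measurableT_comp => //; apply: measurable_funD => //.
  exact: (measurableT_comp (madd c)).
have K0 z : (0 <= K z)%E by exact: Psi0.
have -> : (\int[mu]_x cube_moment y a p (x + c)%R = \int[mu]_x \int[gauss a]_g K (x, g))%E.
  apply: eq_integral => x _; apply: eq_integral => g _; apply: eq_integral => j _.
  by rewrite /f/=; congr (cube_pos _)%:E; ring.
rewrite (fubini_tonelli K mK K0) -cube_moment_conv//.
apply: ge0_le_integral => //.
- by move=> g _; exact: integral_ge0.
- exact: measurable_fun_fubini_tonelli_G.
- have mg := measurable_pois_integral y p (measurable_cube_moment y b q) (cube_moment_ge0 y b q).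
  have m2 := measurable_pois_integral y p (measurableT_comp (measurable_cube_moment y b q) (madd c))
    (fun x => cube_moment_ge0 y b q (x + c)).
  exact: m2.
move=> g _.
pose L (z : R * nat) := f (z.1 + (g + y * (z.2%:R - p) + c)).
have mL : measurable_fun setT L.
  apply: measurableT_comp => //; apply: measurable_funD => //.
  exact: (measurableT_comp (measurable_fun_nat (fun k : nat => g + y * (k%:R - p) + c)) measurable_snd).
have L0 z : (0 <= L z)%E by exact: f0.
have -> : (\int[mu]_x K (x, g) = \int[mu]_x \int[pois p]_j L (x, j))%E.
  apply: eq_integral => x _; apply: eq_integral => j _.
  by rewrite /f; congr (cube_pos _)%:E; rewrite /=; ring.
rewrite (fubini_tonelli L mL L0).
apply: ge0_le_integral => //.
  by move=> j _; exact: integral_ge0.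
move=> j _; apply: le_trans (taylor_bound_le_cube_moment _ y0 b0 q0).
apply: le_trans (hX _); rewrite /L/=.
by rewrite (@ge0_integral_distribution _ _ _ _ _ _ X (fun s => f (s + (g + y * (j%:R - p) + c))%R))//=;
  exact: measurableT_comp.
Qed.

Variables (n : nat) (X : 'I_n -> {RV P >-> R}).
Hypothesis Xindep : mutually_independent P X.

Lemma sum_le_cube_moment y a p (v th : 'I_n -> R) :
  0 < y -> 0 <= a -> 0 <= p -> (forall i, 0 <= v i) -> (forall i, 0 <= th i) ->
  (forall i c, \int[P]_w (cube_pos (X i w + c))%:E <= (taylor_bound y (v i) (th i) c)%:E)%E ->
  forall c, (\int[P]_w (cube_pos (\sum_i X i w + c))%:E <=
    cube_moment y (a + \sum_i v i)%R (p + \sum_i th i)%R c)%E.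
Proof.
move=> y0 a0 p0 v0 th0 hX.
have main k : (k <= n)%N -> forall c, (\int[P]_w (cube_pos (partial_sum X k w + c))%:E <=
    cube_moment y (a + \sum_(i < n | (i < k)%N) v i)%R (p + \sum_(i < n | (i < k)%N) th i)%R c)%E.
  elim: k => [_ c|k IH kn c].
    rewrite !big_pred0// !addr0.
    apply: (@le_trans _ _ (cube_pos c)%:E).
      under eq_integral do rewrite partial_sum0 add0r.
      rewrite integral_cst// [X in (_ * X <= _)%E](_ : _ = 1%E) ?mule1//; last exact: probability_setT.
    apply: le_trans (taylor_bound_le_cube_moment c y0 a0 p0); rewrite lee_fin /taylor_bound -addrA lerDl.
    by rewrite addr_ge0 ?mulr_ge0 ?pospart_ge0 ?jump_term_ge0// ltW.
  pose i := Ordinal kn.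
  have sumS (u : 'I_n -> R) :
      \sum_(j < n | (j < k.+1)%N) u j = \sum_(j < n | (j < k)%N) u j + u i.
    rewrite (bigD1 i)//= addrC; congr (_ + _).
    by apply: eq_bigl => j; rewrite ltnS ltn_neqAle andbC.
  rewrite !sumS !addrA.
  under eq_integral do rewrite (partial_sumS X i).
  apply: (add_independent_le_cube_moment y0 _ (v0 i) _ (th0 i) (partial_sum_indep Xindep i)
    (IH (ltnW kn)) (hX i)).
  - by rewrite addr_ge0// sumr_ge0.
  - by rewrite addr_ge0// sumr_ge0.
move=> c; have := main n (leqnn n) c.
under eq_integral do rewrite partial_sumT.
have allE (u : 'I_n -> R) : \sum_(j < n | (j < n)%N) u j = \sum_j u j.
  by apply: eq_bigl => j; rewrite ltn_ord.
by rewrite !allE.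
Qed.

End sum_comparison.

Section third_moment_comparison.
Context (R : realType) (sigma y beta : R).
Hypotheses (sigma0 : 0 < sigma) (y0 : 0 < y).
Variable (eps : R).
Hypotheses (eps_def : eps = beta / (sigma ^+ 2 * y)) (eps01 : 0 < eps < 1).

Context (d : measure_display) (T : measurableType d) (P : probability T R).
Context (n : nat) (X : 'I_n -> {RV P >-> R}).
Hypothesis Xindep : mutually_independent P X.
Hypothesis X2 :
  (\sum_(i < n) 'E_P[fun w => (X i w ^+ 2)%R] <= (sigma ^+ 2)%:E)%E.
Hypothesis X3 :
  (\sum_(i < n) 'E_P[fun w => (pospart (X i w) ^+ 3)%R] <= beta%:E)%E.
Hypothesis X1 : forall i, ('E_P[X i] <= 0)%E.
Hypothesis Xy : forall i, {ae P, forall w, X i w <= y}.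

Let sume_fin (F : 'I_n -> \bar R) r : (forall i, 0 <= F i)%E ->
  (\sum_(i < n) F i <= r%:E)%E ->
  (forall i, F i = (fine (F i))%:E) /\ \sum_(i < n) fine (F i) <= r.
Proof.
move=> F0 Fr; have FE i : F i = (fine (F i))%:E.
  rewrite fineK// ge0_fin_numE//; apply: le_lt_trans (ltry r); apply: le_trans Fr.
  by rewrite (bigD1 i)//= leeDl// sume_ge0.
split=> //; rewrite -lee_fin -sumEFin.
by under eq_bigr do rewrite -FE.
Qed.

(** The parameters [v i], [th i] have to match the moments of [X i] from above and
  add up exactly to those of the law of [eta]. Variance missing from the sum is put
  into the starting point of the induction. If the third moments do not reach
  [beta], the same fraction [k] of each Gaussian variance is moved to the Poisson
  part, which raises third moments only; the variance of [X i] leaves room for it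
  because [b i <= y * s i]. *)
Lemma sum_third_moment_le c :
  (\int[P]_w (cube_pos (\sum_i X i w + c))%:E <=
   cube_moment y ((1 - eps) * sigma ^+ 2) (eps * sigma ^+ 2 / y ^+ 2) c)%E.
Proof.
have /andP[eps0 eps1] := eps01.
have y0' := ltW y0.
have betaE : beta = eps * (sigma ^+ 2 * y) by rewrite eps_def; field; rewrite !gt_eqF.
have sig20 : 0 < sigma ^+ 2 by rewrite exprn_gt0.
have E20 i : (0 <= 'E_P[fun w => (X i w ^+ 2)%R])%E.
  by apply: expectation_ge0 => w; rewrite sqr_ge0.
have E30 i : (0 <= 'E_P[fun w => cube_pos (X i w)])%E.
  by apply: expectation_ge0 => w; rewrite cube_pos_ge0.
have [s_E S_le] := sume_fin E20 X2.
have [b_E B_le] := sume_fin E30 X3.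
pose s i := fine 'E_P[fun w => (X i w ^+ 2)%R].
pose b i := fine 'E_P[fun w => cube_pos (X i w)].
rewrite -/(s _) in S_le; rewrite -/(b _) in B_le.
have s_ge0 i : 0 <= s i by rewrite fine_ge0.
have b_ge0 i : 0 <= b i by rewrite fine_ge0.
have bs i : b i <= y * s i.
  rewrite -lee_fin EFinM -/(b i) /b /s -b_E -s_E unlock.
  have mX : measurable_fun setT (X i) by exact: measurable_funP.
  have mX2 : measurable_fun setT (fun w => X i w ^+ 2) by exact: measurable_funX.
  have mX2E : measurable_fun setT (fun w => (X i w ^+ 2)%:E) by exact/measurable_EFinP.
  have X2E w : setT w -> (0 <= (X i w ^+ 2)%:E)%E by rewrite lee_fin sqr_ge0.
  rewrite -(ge0_integralZl P measurableT mX2E X2E) ?lee_fin//.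
  apply: ae_ge0_le_integral => //.
  - by move=> w _; rewrite lee_fin cube_pos_ge0.
  - apply/measurable_EFinP; apply: measurableT_comp => //; exact: measurable_cube_pos.
  - by move=> w _; rewrite -EFinM lee_fin mulr_ge0 ?sqr_ge0.
  - by apply/measurable_EFinP; exact: measurable_funM.
  apply: filterS (Xy i) => w Xwy _; rewrite -EFinM lee_fin.
  have [x0|/ltW x0] := leP 0 (X i w).
    by rewrite cube_pos_id// exprS ler_wpM2r ?sqr_ge0.
  by rewrite cube_pos_eq0// mulr_ge0 ?sqr_ge0.
set S := \sum_(i < n) _ in S_le; set B := \sum_(i < n) _ in B_le.
have gap : 0 < y * sigma ^+ 2 - B.
  rewrite subr_gt0; apply: le_lt_trans B_le _.
  by rewrite betaE (mulrC y) gtr_pMl// mulr_gt0.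
pose k := (beta - B) / (y * sigma ^+ 2 - B).
have k0 : 0 <= k by apply: divr_ge0; [rewrite subr_ge0|exact: ltW].
have k1 : k <= 1.
  rewrite ler_pdivrMr// mul1r lerD2r betaE (mulrC y).
  by apply: ler_piMl; [rewrite mulr_ge0// ltW|exact: ltW].
pose v i := (1 - k) * (s i - b i / y).
pose th i := (b i + k * (y * s i - b i)) / y ^+ 3.
have v_ge0 i : 0 <= v i.
  by rewrite mulr_ge0 ?subr_ge0// ler_pdivrMr// mulrC.
have th_ge0 i : 0 <= th i.
  by rewrite divr_ge0 ?exprn_ge0// addr_ge0// mulr_ge0// subr_ge0.
have step i c' : (\int[P]_w (cube_pos (X i w + c'))%:E <=
    (taylor_bound y (v i) (th i) c')%:E)%E.
  apply: (expectation_cube_pos_le c' y0 (th_ge0 i) (Xy i) (X1 i) (s_E i) (b_E i)).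
  - rewrite -/(s i) /v /th le_eqVlt; apply/orP; left; apply/eqP.
    by field; rewrite gt_eqF.
  - rewrite -/(b i) /th mulrCA divff ?gt_eqF ?exprn_gt0// mulr1 lerDl.
    by rewrite mulr_ge0// subr_ge0.
have a0 : 0 <= (1 - k) * (sigma ^+ 2 - S) by rewrite mulr_ge0 ?subr_ge0.
have p0 : 0 <= k * (sigma ^+ 2 - S) / y ^+ 2.
  by rewrite divr_ge0 ?sqr_ge0// mulr_ge0 ?subr_ge0.
have := sum_le_cube_moment Xindep y0 a0 p0 v_ge0 th_ge0 step c.
have -> : \sum_i v i = (1 - k) * (S - B / y).
  by rewrite -mulr_sumr sumrB -mulr_suml.
have -> : \sum_i th i = (B + k * (y * S - B)) / y ^+ 3.
  by rewrite -mulr_suml big_split/= -mulr_sumr sumrB -mulr_sumr.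
have kE : k * (y * sigma ^+ 2 - B) = beta - B by rewrite /k mulfVK// gt_eqF.
have -> : (1 - k) * (sigma ^+ 2 - S) + (1 - k) * (S - B / y) = (1 - eps) * sigma ^+ 2.
  have -> : (1 - eps) * sigma ^+ 2 = (y * sigma ^+ 2 - beta) / y.
    by rewrite betaE; field; rewrite gt_eqF.
  have -> : beta = k * (y * sigma ^+ 2 - B) + B by rewrite kE; ring.
  by field; rewrite gt_eqF.
have -> : k * (sigma ^+ 2 - S) / y ^+ 2 + (B + k * (y * S - B)) / y ^+ 3 =
    eps * sigma ^+ 2 / y ^+ 2.
  have -> : eps * sigma ^+ 2 / y ^+ 2 = beta / y ^+ 3.
    by rewrite betaE; field; rewrite gt_eqF.
  have -> : beta = k * (y * sigma ^+ 2 - B) + B by rewrite kE; ring.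
  by field; rewrite gt_eqF.
by [].
Qed.

End third_moment_comparison.

Section eta_law.
Context (R : realType) (d : measure_display) (U : measurableType d) (Q : probability U R).
Context (G : {RV Q >-> R}) (N : {RV Q >-> nat}).
Variables (v th y : R).
Hypothesis v0 : 0 < v.
Hypothesis GN : independent2 Q G N.
Hypothesis Glaw : has_law Q G (gaussian_law v).
Hypothesis Nlaw : has_law Q N (poisson_law th).

Lemma distribution_gauss A : measurable A -> distribution Q G A = gauss v A.
Proof. by move=> mA; rewrite Glaw// gauss.unlock gt_eqF. Qed.

Lemma distribution_pois A : measurable A -> distribution Q N A = pois th A.
Proof. by move=> mA; rewrite Nlaw// pois.unlock. Qed.

(** The two measures live on copies of the Borel space with different displays,
  which the identity map relates. *)
Lemma integral_distribution_gauss (h : R -> \bar R) :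
  measurable_fun setT h -> (forall x, 0 <= h x)%E ->
  (\int[distribution Q G]_x h x = \int[gauss v]_x h x)%E.
Proof.
move=> mh h0; pose tr := (fun x => x) : measurableTypeR R -> R.
have mtr : measurable_fun setT tr by exact: measurable_id.
transitivity (\int[pushforward (gauss v) tr]_x h x)%E; last first.
  by rewrite ge0_integral_pushforward.
by apply: eq_measure_integral => A mA _; exact: distribution_gauss.
Qed.

Lemma integral_gauss_pois (f : R * nat -> \bar R) :
  measurable_fun setT f -> (forall z, 0 <= f z)%E ->
  (\int[Q]_w f (G w, N w) = \int[gauss v]_g \int[pois th]_k f (g, k))%E.
Proof.
move=> mf f0; rewrite (integral_independent2 GN mf f0).
rewrite integral_distribution_gauss; last 2 first.
- exact: measurable_fun_fubini_tonelli_F.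
- by move=> g; exact: integral_ge0.
apply: eq_integral => g _; apply: eq_measure_integral => A mA _.
exact: distribution_pois.
Qed.

Lemma expectation_eta t :
  ('E_Q[fun w => (pospart (G w + y * ((N w)%:R - th) - t) `^ 3)%R] = cube_moment y v th (- t)%R)%E.
Proof.
rewrite unlock.
pose f (z : R * nat) := (cube_pos (z.1 + y * (z.2%:R - th) - t))%:E.
rewrite /cube_moment -(@integral_gauss_pois f).
- apply: eq_integral => w _; rewrite /f/= /cube_pos.
  by rewrite (powR_mulrn 3)// pospart_ge0.
- apply/measurable_EFinP; apply: measurableT_comp; first exact: measurable_cube_pos.
  apply: measurable_funD => //; apply: measurable_funD => //.
  exact: (measurableT_comp (measurable_fun_nat (fun k : nat => y * (k%:R - th))) measurable_snd).
- by move=> z; rewrite lee_fin cube_pos_ge0.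
Qed.

End eta_law.

(** * From third moments to log-concave tails *)

Section layer_cake.
Context {R : realType}.
Notation mu := (@lebesgue_measure R).
Implicit Types (l r t u w x : R).

(** Up to the factor [3], the integral is [Gamma 3 / l ^+ 3]; it is the source of the
  constant [c30]. *)
Lemma integral_sqr_expR l : 0 < l ->
  (\int[mu]_(r in `[0%R, +oo[) (3 * r ^+ 2 * expR (- (l * r)))%:E = (6 / l ^+ 3)%:E)%E.
Proof.
move=> l0.
pose F r := - ((3 * r ^+ 2 / l + 6 * r / l ^+ 2 + 6 / l ^+ 3) * expR (- (l * r))).
have dE x : is_derive x 1 (fun r => expR (- (l * r))) (- l * expR (- (l * x))).
  have d1 : is_derive x 1 (fun r => - (l * r)) (- l).
    by apply: is_derive_eq; rewrite /GRing.scale/= mulr1.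
  by apply: is_derive_eq; rewrite /GRing.scale/= mulrC.
have dF x : is_derive x 1 F (3 * x ^+ 2 * expR (- (l * x))).
  have dp : is_derive x 1 (fun r => 3 * r ^+ 2 / l + 6 * r / l ^+ 2 + 6 / l ^+ 3)
      (6 * x / l + 6 / l ^+ 2).
    apply: is_derive_eq; rewrite /GRing.scale/=; field.
    by rewrite gt_eqF.
  apply: is_derive_eq; rewrite /GRing.scale/=; field.
  by rewrite gt_eqF.
have cE : continuous (fun r => expR (- (l * r))).
  by move=> x; apply/differentiable_continuous/derivable1_diffP; exact: ex_derive.
have cF : continuous F.
  by move=> x; apply/differentiable_continuous/derivable1_diffP; exact: ex_derive.
rewrite (@ge0_continuous_FTC2y _ _ F 0 0)//.
- by rewrite -EFinB /F (mulr0 l) oppr0 expR0; congr EFin; ring.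
- by move=> x x0; rewrite !mulr_ge0 ?expR_ge0 ?sqr_ge0.
- apply: continuous_subspaceT => x; apply: cvgM; last exact: cE.
  by apply: cvgM; [exact: cvg_cst|exact: exprn_continuous].
- pose C := 3 / l + 6 / l ^+ 2 + 6 / l ^+ 3.
  have C0 : 0 < C by rewrite /C !addr_gt0 ?divr_gt0 ?exprn_gt0.
  pose K := C * (6 / l ^+ 3).
  have K0 : 0 < K by rewrite mulr_gt0 ?divr_gt0 ?exprn_gt0.
  apply/cvgrPdist_le => e e0; near=> r.
  have r1 : 1 <= r by near: r; exact: nbhs_pinfty_ge.
  have rK : K / e <= r by near: r; apply: nbhs_pinfty_ge; exact: num_real.
  have r0 : 0 < r by exact: lt_le_trans ltr01 r1.
  have r0' := ltW r0; have l0' := ltW l0.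
  have p0 : 0 <= 3 * r ^+ 2 / l + 6 * r / l ^+ 2 + 6 / l ^+ 3.
    by apply: addr_ge0; [apply: addr_ge0|]; apply: divr_ge0; rewrite ?exprn_ge0// mulr_ge0// sqr_ge0.
  have lr0 : 0 < l * r by rewrite mulr_gt0.
  rewrite sub0r /F opprK ger0_norm; last first.
    by rewrite mulr_ge0 ?expR_ge0.
  have eb : expR (- (l * r)) <= 6 / (l * r) ^+ 3.
    rewrite expRN -invf_div lef_pV2 ?posrE ?expR_gt0//; last first.
      by rewrite divr_gt0 ?exprn_gt0.
    have := expR_ge1Dxn 2 (ltW lr0); rewrite (_ : 3`!%:R = 6 :> R)//; lra.
  apply: (@le_trans _ _ (C * r ^+ 2 * (6 / (l * r) ^+ 3))).
    apply: ler_pM => //.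
    have h1 : 0 <= 6 / l ^+ 2 * (r ^+ 2 - r).
      by rewrite mulr_ge0 ?divr_ge0 ?exprn_ge0 ?(ltW l0)// subr_ge0 expr2 ler_peMl// ltW.
    have h2 : 0 <= 6 / l ^+ 3 * (r ^+ 2 - 1).
      by rewrite mulr_ge0 ?divr_ge0 ?exprn_ge0 ?(ltW l0)// subr_ge0 exprn_ege1.
    rewrite /C; lra.
  have -> : C * r ^+ 2 * (6 / (l * r) ^+ 3) = K / r.
    by rewrite /K; field; rewrite !gt_eqF.
  by rewrite ler_pdivrMr// mulrC -ler_pdivrMr.
- exact/cvg_at_right_filter/cF.
- by move=> x _; rewrite derive1E; exact: derive_val.
Unshelve. all: end_near. Qed.

Lemma integral_sqr w : 0 < w ->
  (\int[mu]_(r in `[0%R, w]) (3 * r ^+ 2)%:E = (w ^+ 3)%:E)%E.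
Proof.
move=> w0; pose F r := r ^+ 3 : R.
have dF x : is_derive x 1 F (3 * x ^+ 2).
  by apply: is_derive_eq; rewrite /GRing.scale/=; ring.
have cF x : {for x, continuous F} by exact: exprn_continuous.
rewrite (@continuous_FTC2 _ _ F)//.
- by rewrite /F expr0n/= sube0.
- apply: continuous_subspaceT => x.
  by apply: cvgM; [exact: cvg_cst|exact: exprn_continuous].
- split.
  + by move=> x _; exact: ex_derive.
  + exact/cvg_at_right_filter/cF.
  + exact/cvg_at_left_filter/cF.
- by move=> x _; rewrite derive1E; exact: derive_val.
Qed.

End layer_cake.

Section exponential_tail.
Context (R : realType) d (U : measurableType d) (Q : probability U R).
Context (Y : U -> R) (mY : measurable_fun setT Y).
Notation mu := (@lebesgue_measure R).
Implicit Types (M l t u x : R).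

Lemma measurable_tail u : measurable [set w | u <= Y w].
Proof.
rewrite (_ : [set w | u <= Y w] = setT `&` Y @^-1` `[u, +oo[%classic); first exact: mY.
by rewrite setTI; apply/seteqP; split => w /=; rewrite in_itv/= andbT.
Qed.

Lemma tailE u : Q [set w | u <= Y w] = (tail Q Y u)%:E.
Proof. by rewrite /tail fineK// fin_num_measure//; exact: measurable_tail. Qed.

(** Layer-cake formula: the left-hand side is the integral of
  [3 * r ^+ 2 * tail Q Y (t + r)] over [r >= 0]. *)
Lemma exponential_tail_cube_pos M l t : 0 < l ->
  (forall u, t <= u -> tail Q Y u <= M * expR (- (l * (u - t)))) ->
  (\int[Q]_w (cube_pos (Y w - t))%:E <= (M * (6 / l ^+ 3))%:E)%E.
Proof.
move=> l0 tailM.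
have M0 : 0 <= M.
  have := tailM t (lexx t); rewrite subrr mulr0 oppr0 expR0 mulr1.
  by apply: le_trans; rewrite fine_ge0.
pose A := [set z : U * measurableTypeR R | 0 <= z.2 /\ z.2 <= Y z.1 - t].
have mA : measurable A.
  have -> : A = (setT `&` snd @^-1` `[(0 : R), +oo[%classic) `&`
      (setT `&` (fun z : U * measurableTypeR R => Y z.1 - t - z.2) @^-1` `[(0 : R), +oo[%classic).
    rewrite !setTI; apply/seteqP.
    by split=> z /=; rewrite !in_itv/= !andbT subr_ge0.
  apply: measurableI; first exact: measurable_snd.
  have mf : measurable_fun setT (fun z : U * measurableTypeR R => Y z.1 - t - z.2).
    apply: measurable_funB => //; apply: measurable_funB => //.
    exact: (measurableT_comp mY measurable_fst).
  exact: mf.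
pose k z := (3 * z.2 ^+ 2 * \1_A z)%:E : \bar R.
have sq0 (r : R) : 0 <= 3 * r ^+ 2 by apply: mulr_ge0 => //; exact: sqr_ge0.
have k0 z : (0 <= k z)%E by rewrite lee_fin mulr_ge0.
have msq : measurable_fun setT (fun r : R => 3 * r ^+ 2).
  by apply: measurable_funM => //; exact: measurable_funX.
have mk : measurable_fun setT k.
  apply/measurable_EFinP; apply: measurable_funM; last exact: measurable_indic.
  exact: (measurableT_comp msq measurable_snd).
apply: (@le_trans _ _ (\int[Q]_w \int[mu]_r k (w, r))%E).
  apply: ge0_le_integral => //.
  - by move=> w _; rewrite lee_fin cube_pos_ge0.
  - apply/measurable_EFinP; apply: measurableT_comp; first exact: measurable_cube_pos.
    exact: measurable_funB.
  - exact: measurable_fun_fubini_tonelli_F.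
  move=> w _; have [Yt|Yt] := leP (Y w - t) 0.
    by rewrite cube_pos_eq0//; exact: integral_ge0.
  rewrite cube_pos_id ?(ltW Yt)// -integral_sqr//.
  apply: (@le_trans _ _ (\int[mu]_(r in `[0%R, (Y w - t)%R]) k (w, r))%E).
    rewrite le_eqVlt; apply/orP; left; apply/eqP; apply: eq_integral => r.
    rewrite inE/= in_itv/= => r01; rewrite /k/= indicE mem_set ?mulr1//.
    by rewrite /A/=; apply/andP.
  apply: ge0_subset_integral => //.
  apply: measurable_funTS; exact: (measurableT_comp mk (pair1_measurable w)).
rewrite fubini_tonelli//.
apply: (@le_trans _ _ (\int[mu]_(r in `[0%R, +oo[) (M * (3 * r ^+ 2 * expR (- (l * r))))%:E)%E); last first.
  under eq_integral do rewrite EFinM.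
  rewrite ge0_integralZl//.
  - by rewrite integral_sqr_expR// EFinM.
  - apply/measurable_EFinP/measurable_funTS; apply: measurable_funM => //.
    by apply: measurableT_comp => //; apply: measurableT_comp => //; exact: measurable_funM.
  - by move=> r _; rewrite lee_fin mulr_ge0 ?expR_ge0.
rewrite [leRHS]integral_mkcond; apply: ge0_le_integral => //.
- by move=> r _; exact: integral_ge0.
- exact: measurable_fun_fubini_tonelli_G.
- apply/(measurable_restrictT _ _).1 => //; apply/measurable_EFinP/measurable_funTS.
  apply: measurable_funM => //; apply: measurable_funM => //.
  by apply: measurableT_comp => //; apply: measurableT_comp => //; exact: measurable_funM.
move=> r _; rewrite patchE.
have [r0|r0] := leP 0 r; last first.
  rewrite memNset; last by rewrite /= in_itv/= andbT leNgt r0.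
  rewrite integral0_eq// => w _; rewrite /k/= indicE memNset ?mulr0//.
  by rewrite /A/= leNgt r0 => -[].
rewrite mem_set; last by rewrite /= in_itv/= andbT.
have -> : (\int[Q]_w k (w, r) = (3 * r ^+ 2)%:E * Q [set w | (r + t <= Y w)%R])%E.
  rewrite -[X in Q X]setIT -integral_indic//; last exact: measurable_tail.
  rewrite -ge0_integralZl//.
  - apply: eq_integral => w _; rewrite /k EFinM; congr (_ * _%:E)%E.
    rewrite !indicE; congr (_%:R); congr nat_of_bool.
    apply/idP/idP; rewrite !inE /A/=; first by case=> _; rewrite lerBrDr.
    by rewrite -lerBrDr.
  - by apply/measurable_EFinP; apply: measurable_indic; exact: measurable_tail.
  - by rewrite lee_fin.
rewrite tailE -EFinM lee_fin [leRHS]mulrCA; apply: ler_wpM2l => //.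
by have := tailM (r + t); rewrite lerDr addrK => /(_ r0).
Qed.

End exponential_tail.

Section log_concave_tail.
Context (R : realType).
Implicit Types (h : R -> R) (l t u x : R).

(** The concave function [ln h] has a supporting line at [x]; the supremum of the
  slopes of its chords to the right of [x] may serve as slope. *)
Lemma log_concave_supergradient h x : log_concave h -> (forall u, 0 < h u) ->
  exists l, forall u, h u <= h x * expR (- (l * (u - x))).
Proof.
move=> [_ hlc] h0; pose k u := ln (h u).
have hE u : h u = expR (k u) by rewrite /k lnK// posrE.
have conc a b : a < x -> x < b -> (x - a) * (k b - k x) <= (b - x) * (k x - k a).
  move=> ax xb; have ab : 0 < b - a by lra.
  pose t := (b - x) / (b - a).
  have t01 : 0 <= t <= 1.
    by apply/andP; split; [rewrite divr_ge0//; lra|rewrite ler_pdivrMr//; lra].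
  have := hlc a b t t01.
  have -> : t * a + (1 - t) * b = x by rewrite /t; field; rewrite gt_eqF.
  rewrite !hE -!expRM -expRD ler_expR => kx.
  have := ler_wpM2r (ltW ab) kx.
  have -> : (k a * t + k b * (1 - t)) * (b - a) = (b - x) * k a + (x - a) * k b.
    by rewrite /t; field; rewrite gt_eqF.
  lra.
pose E := [set (k b - k x) / (b - x) | b in [set b | x < b]].
have Eub a : a < x -> ubound E ((k x - k a) / (x - a)).
  move=> ax _ [b /= xb <-]; rewrite ler_pdivrMr ?subr_gt0// mulrAC.
  rewrite ler_pdivlMr ?subr_gt0// mulrC [leRHS]mulrC; exact: conc.
have Esup : has_sup E.
  split; first by exists ((k (x + 1) - k x) / (x + 1 - x)), (x + 1) => //=; rewrite ltrDl.
  by exists ((k x - k (x - 1)) / (x - (x - 1))); apply: Eub; rewrite gtrDl ltrN10.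
exists (- sup E) => u; rewrite mulNr opprK !hE -expRD ler_expR -lerBlDl.
have [ux|xu|->] := ltgtP u x; last by rewrite !subrr mulr0.
  have : sup E <= (k x - k u) / (x - u) by apply: ge_sup; [exact: Esup.1|exact: Eub].
  rewrite ler_pdivlMr ?subr_gt0//; lra.
have : (k u - k x) / (u - x) <= sup E.
  by apply: ub_le_sup; [exact: Esup.2|exists u].
by rewrite ler_pdivrMr ?subr_gt0.
Qed.

Lemma c30_ge : 16 / 9 <= c30 R.
Proof.
rewrite /c30 ler_pM2r ?invr_gt0//.
have e2 : 2 <= expR 1 :> R by have := @expR_ge1Dx R 1; lra.
have : (2 : R) ^+ 3 <= expR 1 ^+ 3 by rewrite lerXn2r ?nnegrE ?expR_ge0.
lra.
Qed.

Context d (U : measurableType d) (Q : probability U R) (Y : {RV Q >-> R}).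

Let mY : measurable_fun setT Y. Proof. exact: measurable_funP. Qed.

Lemma P_alpha_le t x : t < x ->
  (P_alpha Q 3 Y x <= (\int[Q]_w (cube_pos (Y w - t))%:E) * (((x - t) ^+ 3)^-1)%:E)%E.
Proof.
move=> tx; apply: ereal_inf_lbound; exists t => /=; first by rewrite in_itv.
rewrite unlock (powR_mulrn 3) ?subr_ge0 ?(ltW tx)//; congr (_ * _)%E.
by apply: eq_integral => w _; rewrite (powR_mulrn 3) ?pospart_ge0.
Qed.

Lemma cube_pos_shift_le s (p : R) : 0 <= s ->
  cube_pos (p + s) <= s ^+ 3 + (3 * s ^+ 2 + 3 * s + 1) * (1 + cube_pos p).
Proof.
move=> s0; apply: (@le_trans _ _ (cube_pos (pospart p + s))).
  by rewrite le_cube_pos// lerD2r pospart_ge.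
have p0 := pospart_ge0 p; rewrite cube_pos_id ?addr_ge0// /cube_pos.
set q := pospart p in p0 *.
have q3 : 0 <= q ^+ 3 by rewrite exprn_ge0.
have h1 : q <= 1 + q ^+ 3.
  have [q1|/ltW q1] := leP q 1; first lra.
  have : q <= q ^+ 3 by rewrite -[leLHS]expr1 ler_weXn2l.
  lra.
have h2 : q ^+ 2 <= 1 + q ^+ 3.
  have [q1|/ltW q1] := leP q 1.
    have : q ^+ 2 <= 1 by rewrite exprn_ile1.
    lra.
  have : q ^+ 2 <= q ^+ 3 by rewrite ler_weXn2l.
  lra.
have h3 := ler_wpM2l (sqr_ge0 s) h1.
have h4 := ler_wpM2l s0 h2.
lra.
Qed.

(** As [t] tends to [-oo], the quotient defining [P_alpha] tends to [1], and
  [c30 * q] is at least [8 / 5]. The third moment of the positive part of [Y] makes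
  this quantitative. *)
Lemma P_alpha_le_c30_near1 (q x : R) : (\int[Q]_w (cube_pos (Y w))%:E < +oo)%E ->
  9 / 10 <= q -> (P_alpha Q 3 Y x <= (c30 R * q)%:E)%E.
Proof.
move=> Yfin q9.
have mYc : measurable_fun setT (fun w => (cube_pos (Y w))%:E).
  by apply/measurable_EFinP; apply: measurableT_comp => //; exact: measurable_cube_pos.
have [m m0 mE] : exists2 m : R, 0 <= m & (\int[Q]_w (cube_pos (Y w))%:E = m%:E)%E.
  have Y0 : (0 <= \int[Q]_w (cube_pos (Y w))%:E)%E.
    by apply: integral_ge0 => w _; rewrite lee_fin cube_pos_ge0.
  exists (fine (\int[Q]_w (cube_pos (Y w))%:E)%E); first exact: fine_ge0.
  by rewrite fineK// ge0_fin_numE.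
(* With [K] dominating [1], [`|x|] and [1 + m], the point [t = - s] at distance
   [40 * K] from [x] is far enough to bring the quotient below [6 / 5]. *)
pose K := `|x| + (1 + m).
have K1 : 1 <= K by rewrite /K; have := normr_ge0 x; lra.
have K0 : 0 < K by lra.
have xK : `|x| <= K by rewrite /K; lra.
have mK : 1 + m <= K by rewrite /K; have := normr_ge0 x; lra.
have /andP[xK1 xK2] : - K <= x <= K by rewrite -ler_norml.
pose s := 40 * K - x.
have s0 : 0 <= s by rewrite /s; lra.
have sK : s <= 41 * K by rewrite /s; lra.
have tx : - s < x by rewrite /s; lra.
apply: le_trans (P_alpha_le tx) _; rewrite !opprK.
have -> : x + s = 40 * K by rewrite /s; ring.
have int_le : (\int[Q]_w (cube_pos (Y w + s))%:E <=
    (s ^+ 3 + (3 * s ^+ 2 + 3 * s + 1) * (1 + m))%:E)%E.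
  have c0 : 0 <= 3 * s ^+ 2 + 3 * s + 1 by have := sqr_ge0 s; lra.
  have a0 : 0 <= s ^+ 3 + (3 * s ^+ 2 + 3 * s + 1) by rewrite addr_ge0 ?exprn_ge0.
  apply: (@le_trans _ _ (\int[Q]_w ((s ^+ 3 + (3 * s ^+ 2 + 3 * s + 1))%:E +
      (3 * s ^+ 2 + 3 * s + 1)%:E * (cube_pos (Y w))%:E))%E).
    apply: ge0_le_integral => //.
    - by move=> w _; rewrite lee_fin cube_pos_ge0.
    - apply/measurable_EFinP; apply: measurableT_comp; first exact: measurable_cube_pos.
      exact: measurable_funD.
    - apply: emeasurable_funD => //; exact: emeasurable_funM.
    - move=> w _; rewrite -EFinM -EFinD lee_fin.
      by apply: le_trans (cube_pos_shift_le _ s0) _; lra.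
  rewrite (ge0_integralD Q measurableT)//; last 2 first.
  - by move=> w _; rewrite mule_ge0// lee_fin cube_pos_ge0.
  - exact: emeasurable_funM.
  rewrite integral_cst// [X in (_ * X + _ <= _)%E](_ : _ = 1%E) ?mule1; last exact: probability_setT.
  rewrite (ge0_integralZl Q measurableT mYc)//; last first.
    by move=> w _; rewrite lee_fin cube_pos_ge0.
  by rewrite mE -EFinM -EFinD lee_fin; lra.
have r0 : 0 < (40 * K) ^+ 3 by rewrite exprn_gt0// mulr_gt0.
apply: le_trans (lee_wpmul2r _ int_le) _; first by rewrite lee_fin invr_ge0 ltW.
rewrite -EFinM lee_fin ler_pdivrMr//.
have h1 : s ^+ 3 <= (41 * K) ^+ 3 by rewrite lerXn2r ?nnegrE ?mulr_ge0 ?(ltW K0).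
have h2 : s ^+ 2 <= (41 * K) ^+ 2 by rewrite lerXn2r ?nnegrE ?mulr_ge0 ?(ltW K0).
have h3 : 3 * s ^+ 2 + 3 * s + 1 <= 5167 * K ^+ 2.
  have : 0 <= K * (K - 1) by rewrite mulr_ge0 ?subr_ge0// ltW.
  nra.
have h4 : (3 * s ^+ 2 + 3 * s + 1) * (1 + m) <= 5167 * K ^+ 2 * K.
  by apply: ler_pM => //; [have := sqr_ge0 s; lra|lra].
have cq : 8 / 5 <= c30 R * q.
  have : 16 / 9 * (9 / 10) <= c30 R * q by apply: ler_pM => //; exact: c30_ge.
  lra.
have h5 : 8 / 5 * (40 * K) ^+ 3 <= c30 R * q * (40 * K) ^+ 3 by rewrite ler_pM2r.
have K3 : 0 <= K ^+ 3 by rewrite exprn_ge0// ltW.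
lra.
Qed.

Lemma tail_near_Ny1 x : exists2 u, u <= x & 9 / 10 <= tail Q Y u.
Proof.
have [u ux u9] : exists2 u, u <= x & ((9 / 10)%:E <= ccdf Y u)%E.
  have : \forall u \near -oo%R, ((9 / 10)%:E < ccdf Y u)%E.
    have lt1 : ((9 / 10 : R)%:E < 1)%E by rewrite lte_fin; lra.
    have cv : ccdf Y @ -oo%R --> 1%E by exact: cvg_ccdfNy1.
    exact: (cv _ (open_ereal_gt' lt1)).
  move=> near9.
  near (ninfty_nbhs R) => u.
  exists u; first by near: u; apply: nbhs_ninfty_le; exact: num_real.
  by apply: ltW; near: u.
exists u => //; rewrite -lee_fin -tailE//; apply: le_trans u9 _.
rewrite /ccdf /distribution /pushforward; apply: le_measure; rewrite ?inE.
- by rewrite -[X in measurable X]setTI; exact: measurable_funP.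
- exact: measurable_tail.
- by move=> w /=; rewrite in_itv/= andbT => /ltW.
Unshelve. all: end_near. Qed.

(** A supporting line of [ln h] at [x] bounds the tail by an exponential of rate
  [l]. If [l > 0], the layer-cake bound is best at distance [3 / l] from [x], where
  it yields the constant [c30]. If [l <= 0], then [h x] dominates the tail all the
  way to [-oo], where the tail tends to [1]. *)
Lemma P_alpha_le_c30 h x : (forall u, 0 < tail Q Y u) ->
  (\int[Q]_w (cube_pos (Y w))%:E < +oo)%E ->
  log_concave_majorant (tail Q Y) h -> (P_alpha Q 3 Y x <= (c30 R * h x)%:E)%E.
Proof.
move=> tail0 Yfin [hlc tailh].
have h0 u : 0 < h u by exact: lt_le_trans (tail0 u) (tailh u).
have [l hl] := log_concave_supergradient x hlc h0.
have [l0|l0] := leP l 0.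
  apply: P_alpha_le_c30_near1 => //.
  have [u ux u9] := tail_near_Ny1 x.
  apply: le_trans u9 _; apply: le_trans (tailh u) _; apply: le_trans (hl u) _.
  rewrite ler_piMr ?(ltW (h0 x))// -expR0 ler_expR oppr_le0.
  by rewrite mulr_le0// subr_le0.
pose t := x - 3 / l.
have tx : t < x by rewrite /t gtrDl oppr_lt0 divr_gt0.
apply: le_trans (P_alpha_le tx) _.
have xt : x - t = 3 / l by rewrite /t; ring.
have e3 : expR 1 ^+ 3 = expR 3 :> R by rewrite -expRM_natl mulr1.
have Yt : (\int[Q]_w (cube_pos (Y w - t))%:E <= (h x * expR 3 * (6 / l ^+ 3))%:E)%E.
  apply: exponential_tail_cube_pos => // u _.
  apply: le_trans (tailh u) _; apply: le_trans (hl u) _.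
  rewrite -mulrA -expRD le_eqVlt; apply/orP; left; apply/eqP.
  by congr (_ * expR _); rewrite /t; field; rewrite gt_eqF.
apply: le_trans (lee_wpmul2r _ Yt) _.
  by rewrite lee_fin invr_ge0 xt exprn_ge0// divr_ge0// ltW.
rewrite -EFinM lee_fin /c30 e3 xt le_eqVlt; apply/orP; left; apply/eqP.
by field; rewrite gt_eqF.
Qed.

End log_concave_tail.

(** * The tail bound *)

Section finiteness.
Context {R : realType}.
Implicit Types (g th v y : R).

Lemma pois_cube_lty th : 0 <= th -> (\int[pois th]_k (k%:R ^+ 3 : R)%:E < +oo)%E.
Proof.
move=> th0.
have kE (k : nat) : (k%:R ^+ 3 : R)%:E =
    ((k ^_ 3)%:R%:E + (3%:E * (k ^_ 2)%:R%:E + (k ^_ 1)%:R%:E))%E.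
  by rewrite -EFinM -!EFinD natr_ffact3 natr_ffact2 ffactn1; congr EFin; ring.
under eq_integral do rewrite kE.
have ff0 (c : R) j k : 0 <= c -> (0 <= c%:E * (k ^_ j)%:R%:E)%E.
  by move=> c0; rewrite mule_ge0 ?lee_fin.
rewrite (ge0_integralD (pois th) measurableT)//; last first.
  by move=> k _; rewrite adde_ge0 ?ff0.
rewrite (ge0_integralD (pois th) measurableT)//.
rewrite (ge0_integralZl (pois th) measurableT)// ?lee_fin//.
by rewrite !pois_falling// -EFinM -!EFinD ltry.
Qed.

Lemma cube_pos_le_expR g : cube_pos g <= 6 * expR g.
Proof.
have [g0|/ltW g0] := leP 0 g; last by rewrite cube_pos_eq0// mulr_ge0 ?expR_ge0.
have := expR_ge1Dxn 2 g0; rewrite cube_pos_id// (_ : 3`!%:R = 6 :> R)//; lra.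
Qed.

(** The cube of a sum is at most four times the sum of the cubes; the Gaussian cube
  is dominated by an exponential. *)
Lemma cube_moment_lty y v th : 0 <= y -> 0 <= v -> 0 <= th -> (cube_moment y v th 0 < +oo)%E.
Proof.
move=> y0 v0 th0.
pose m := (\int[pois th]_k (k%:R ^+ 3 : R)%:E)%E.
have m0 : (0 <= m)%E by apply: integral_ge0 => k _; rewrite lee_fin exprn_ge0.
have mfin : m \is a fin_num by rewrite ge0_fin_numE//; exact: pois_cube_lty.
pose C := fine m; have mE : m = C%:E by rewrite fineK.
have C0 : 0 <= C by exact: fine_ge0.
have mexp : measurable_fun setT (fun g => (24 * expR g)%:E : \bar R).
  by apply/measurable_EFinP; exact: measurable_funM.
have ptw g (k : nat) :
    cube_pos (g + y * (k%:R - th) + 0) <= 24 * expR g + 4 * y ^+ 3 * k%:R ^+ 3.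
  set a := pospart g; set b := y * k%:R.
  have a0 : 0 <= a by exact: pospart_ge0.
  have b0 : 0 <= b by rewrite mulr_ge0.
  apply: (@le_trans _ _ (cube_pos (a + b))).
    apply: le_cube_pos; have := pospart_ge g; have := mulr_ge0 y0 th0.
    rewrite -/a /b; lra.
  rewrite cube_pos_id ?addr_ge0//.
  have : 0 <= (a + b) * (a - b) ^+ 2 by rewrite mulr_ge0 ?sqr_ge0// addr_ge0.
  have := cube_pos_le_expR g; rewrite /cube_pos -/a.
  have -> : 4 * y ^+ 3 * k%:R ^+ 3 = 4 * b ^+ 3 by rewrite /b; ring.
  lra.
apply: (@le_lt_trans _ _ (\int[gauss v]_g ((24 * expR g)%:E + (4 * y ^+ 3 * C)%:E))%E).
  apply: ge0_le_integral => //.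
  - by move=> g _; apply: integral_ge0 => k _; rewrite lee_fin cube_pos_ge0.
  - under eq_fun do under eq_integral do rewrite addr0.
    apply: (@measurable_pois_integral _ y th (fun x => (cube_pos x)%:E)).
      by apply/measurable_EFinP; exact: measurable_cube_pos.
    by move=> x; rewrite lee_fin cube_pos_ge0.
  - exact: emeasurable_funD.
  move=> g _.
  apply: (@le_trans _ _ (\int[pois th]_k ((24 * expR g)%:E + (4 * y ^+ 3)%:E * (k%:R ^+ 3)%:E))%E).
    apply: ge0_le_integral => //.
    - by move=> k _; rewrite lee_fin cube_pos_ge0.
    - by move=> k _; rewrite -EFinM -EFinD lee_fin.
  rewrite (ge0_integralD (pois th) measurableT)//; last first.
    by move=> k _; rewrite -EFinM lee_fin !mulr_ge0 ?exprn_ge0.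
  rewrite integral_cst// [X in (_ * X + _ <= _)%E](_ : _ = 1%E) ?mule1; last exact: probability_setT.
  rewrite (ge0_integralZl (pois th) measurableT)//; last first.
    by rewrite lee_fin mulr_ge0 ?exprn_ge0.
  by rewrite -/m mE -EFinM.
rewrite (ge0_integralD (gauss v) measurableT)//; last first.
  by move=> g _; rewrite lee_fin !mulr_ge0 ?exprn_ge0.
rewrite integral_cst// [X in (_ + _ * X < _)%E](_ : _ = 1%E) ?mule1; last exact: probability_setT.
under eq_integral do rewrite EFinM.
rewrite (ge0_integralZl (gauss v) measurableT)//; last first.
  by apply/measurable_EFinP; exact: measurable_expR.
rewrite lte_add_pinfty ?ltry// lte_mul_pinfty// ?lee_fin//.
exact: gauss_expR_lty.
Qed.

End finiteness.

Lemma markov_cube_pos (R : realType) d (T : measurableType d) (P : probability T R)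
    (S : T -> R) (x t : R) : measurable_fun setT S -> t < x ->
  (P [set w | (x <= S w)%R] <=
   (\int[P]_w (cube_pos (S w - t))%:E) * (((x - t) ^+ 3)^-1)%:E)%E.
Proof.
move=> mS tx; have xt0 : 0 < x - t by rewrite subr_gt0.
have r0 : 0 <= ((x - t) ^+ 3)^-1 by rewrite invr_ge0 exprn_ge0// ltW.
have mA := @measurable_tail _ _ _ _ mS x.
have mc : measurable_fun setT (fun w => (cube_pos (S w - t))%:E).
  apply/measurable_EFinP; apply: measurableT_comp; first exact: measurable_cube_pos.
  exact: measurable_funB.
rewrite -(ge0_integralZr P measurableT mc)//; last first.
  by move=> w _; rewrite lee_fin cube_pos_ge0.
rewrite -[X in P X]setIT -integral_indic//.
apply: ge0_le_integral => //.
- by apply/measurable_EFinP; exact: measurable_indic.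
- exact: emeasurable_funM.
move=> w _; rewrite -EFinM lee_fin indicE.
have [xS|xS] := pselect (x <= S w); last first.
  by rewrite memNset// mulr_ge0// cube_pos_ge0.
rewrite mem_set//= ler_pdivlMr ?exprn_gt0// mul1r.
rewrite -[leLHS]cube_pos_id ?(ltW xt0)//.
by rewrite le_cube_pos// lerD2r.
Qed.

Theorem corollary2p6 (R : realType)
    (sigma y beta : R) (hsigma : 0 < sigma) (hy : 0 < y) (hbeta : 0 < beta)
    (eps : R) (eps_def : eps = beta / (sigma ^+ 2 * y)) (heps : 0 < eps < 1)
    (d : measure_display) (T : measurableType d) (P : probability T R)
    (n : nat) (X : 'I_n -> {RV P >-> R})
    (Xindep : mutually_independent P X)
    (X2 : (\sum_(i < n) 'E_P[fun w => (X i w ^+ 2)%R] <= (sigma ^+ 2)%:E)%E)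
    (X3 : (\sum_(i < n) 'E_P[fun w => (pospart (X i w) ^+ 3)%R] <= beta%:E)%E)
    (X1 : forall i, ('E_P[X i] <= 0)%E)
    (Xy : forall i, {ae P, forall w, X i w <= y})
    (d' : measure_display) (U : measurableType d') (Q : probability U R)
    (G : {RV Q >-> R}) (N : {RV Q >-> nat})
    (GNindep : independent2 Q G N)
    (Glaw : has_law Q G (gaussian_law ((1 - eps) * sigma ^+ 2)))
    (Nlaw : has_law Q N (poisson_law (eps * sigma ^+ 2 / y ^+ 2)))
    (x : R) :
  let S := fun w => \sum_(i < n) X i w in
  let eta := fun w => G w + y * ((N w)%:R - eps * sigma ^+ 2 / y ^+ 2) in
  (P [set w | (x <= S w)%R] <= P_alpha Q 3 eta x)%E /\
  (P_alpha Q 3 eta x <= (c30 R * P_LC Q eta x)%:E)%E.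
Proof.
move=> S eta; have /andP[eps0 eps1] := heps.
set v := (1 - eps) * sigma ^+ 2 in Glaw; set th := eps * sigma ^+ 2 / y ^+ 2 in Nlaw eta *.
have v0 : 0 < v by rewrite mulr_gt0 ?subr_gt0 ?exprn_gt0.
have th0 : 0 < th by rewrite divr_gt0 ?mulr_gt0 ?exprn_gt0.
have Eeta t := expectation_eta y v0 GNindep Glaw Nlaw t.
have mS : measurable_fun setT S by apply: measurable_sum => i; exact: measurable_funP.
split.
  apply: le_ereal_inf_tmp => _ [t /= tx <-]; rewrite in_itv/= in tx.
  have xt0 : 0 <= x - t by rewrite subr_ge0 ltW.
  rewrite (powR_mulrn 3 xt0) Eeta.
  apply: le_trans (markov_cube_pos P mS tx) _.
  apply: lee_wpmul2r; first by rewrite lee_fin invr_ge0 exprn_ge0.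
  exact: (sum_third_moment_le hsigma hy eps_def heps Xindep X2 X3 X1 Xy).
have meta : measurable_fun setT eta.
  apply: measurable_funD; first exact: measurable_funP.
  have mN : measurable_fun setT N by exact: measurable_funP.
  have my : measurable_fun setT (fun k : nat => y * (k%:R - th)) by [].
  exact: (measurableT_comp my mN).
pose Y : {RV Q >-> R} := HB.pack eta (isMeasurableFun.Build _ _ _ _ _ meta).
apply: (@P_alpha_le_c30 R d' U Q Y (P_LC Q Y)).
- move=> u; rewrite -lte_fin -tailE//.
  apply: (@lt_le_trans _ _ (Q (G @^-1` `[(u + y * th), +oo[%classic))).
    have -> : Q (G @^-1` `[(u + y * th), +oo[%classic) = gauss v `[(u + y * th), +oo[%classic.
      by rewrite -(distribution_gauss v0 Glaw).
    exact: gauss_tail_gt0.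
  apply: le_measure; rewrite ?inE.
  - by rewrite -[X in measurable X]setTI; exact: measurable_funP.
  - exact: measurable_tail.
  - move=> w; rewrite /= in_itv/= andbT => uG.
    have := mulr_ge0 (ltW hy) (ler0n R (N w)); rewrite /eta; lra.
- have := Eeta 0; rewrite unlock oppr0 => Eeta0.
  have -> : (\int[Q]_w (cube_pos (Y w))%:E = cube_moment y v th 0)%E.
    rewrite -Eeta0; apply: eq_integral => w _.
    by rewrite /= addr0 (powR_mulrn 3) ?pospart_ge0.
  exact: cube_moment_lty (ltW hy) (ltW v0) (ltW th0).
- by have [] := P_LCP Y.
Qed.
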